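(* Let $M=S^2\times S^2\times S^2$ with symplectic form $\omega=\omega_{\mathrm{STD}}\oplus\omega_{\mathrm{STD}}\oplus\omega_{\mathrm{STD}}$ and let $\mathcal{H}=(H,I,J)\colon M\to\mathbb{R}^3$, where $$H(X,Y,Z)=|X+Y+Z|,\qquad I(X,Y,Z)=\langle X+Y+Z,e_3\rangle,\qquad J(X,Y,Z)=\det(X,Y,Z).$$ Then the critical points of $\mathcal{H}$ that lie above the line segment $\{(1,s,0): -1<s<1\}$ (i.e. the critical points $p$ with $\mathcal{H}(p)=(1,s,0)$ for some $-1<s<1$) are non-degenerate and have Williamson type $(0,0,1)$.
   Context: $S^2\subset\mathbb{R}^3$ is the unit sphere, $\langle\cdot,\cdot\rangle$ and $|\cdot|$ are the Euclidean inner product and norm, $e_3=(0,0,1)$, and $\omega_{\mathrm{STD}}$ is the standard area form: $(\omega_{\mathrm{STD}})_z(x\times z,y\times z)=\langle z,x\times y\rangle$ for $z\in S^2$, $x,y\in\mathbb{R}^3$. The function $H$ is smooth on $M\setminus H^{-1}(0)$, in particular near the points with $H=1$; $I$ and $J$ are smooth on $M$. A critical point of $\mathcal{H}$ (with $H\neq 0$) is a point where $dH,dI,dJ$ are linearly dependent, and its rank is the dimension of the span of these differentials. Non-degeneracy: let $p$ be a critical point of rank $n-k$ of an integrable system $(H_1,\dots,H_n)$ on a symplectic manifold $(M^{2n},\omega)$ (here $n=3$). After an invertible linear change of the $H_i$ one may assume $dH_1=\dots=dH_k=0$ at $p$. Let $L\subset T_pM$ be the span of the Hamiltonian vector fields $X_{H_{k+1}},\dots,X_{H_n}$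 at $p$ and $L^\perp$ its symplectic orthocomplement. The operators $\omega^{-1}d^2H_1,\dots,\omega^{-1}d^2H_k$ induce a commutative subalgebra $\mathfrak{h}$ of $\mathfrak{sp}(L^\perp/L)\cong\mathfrak{sp}(\mathbb{R},2k)$ (the symplectic Lie algebra of a $2k$-dimensional symplectic vector space). The point $p$ is non-degenerate if $\mathfrak{h}$ is a Cartan subalgebra; equivalently, the $k$ induced operators are linearly independent and some linear combination of them has $2k$ distinct eigenvalues. Williamson type: a Cartan subalgebra $\mathfrak{h}\subset\mathfrak{sp}(\mathbb{R},2k)$ decomposes as a direct sum of $h_e$ elliptic, $h_h$ hyperbolic and $h_f$ focus-focus blocks, with $h_e+h_h+2h_f=k$, where the eigenvalues of a generic element of $\mathfrak{h}$ are: a pair $\pm iB$ for each elliptic block, a pair $\pm A$ for each hyperbolic block, and a quadruple $A\pm iB,\,-A\pm iB$ for each focus-focus block ($A,B$ nonzero reals). The Williamson type of a non-degenerate critical point is the triple $(h_e,h_h,h_f)$ of its Cartan subalgebra $\mathfrak{h}$. *)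

(* Defs.v *)
From HB Require Import structures.
From mathcomp Require Import all_boot all_order all_algebra.
From mathcomp Require Import all_classical all_reals all_analysis.
From mathcomp Require Import complex.
From mathcomp Require Import ring.

Set Implicit Arguments.
Unset Strict Implicit.
Unset Printing Implicit Defensive.

Import Order.TTheory GRing.Theory Num.Theory.
Import numFieldNormedType.Exports.

Local Open Scope classical_set_scope.
Local Open Scope ring_scope.

(** * Euclidean R^3 *)

Section Euclidean.
Context {R : realType}.
Implicit Types u v : 'rV[R]_3.

Definition dot u v : R := \sum_i u 0 i * v 0 i.

Definition enorm v : R := Num.sqrt (dot v v).

(* The index arithmetic is modulo 3. *)
Definition cross u v : 'rV[R]_3 :=
  \row_i (u 0 (i + 1) * v 0 (i + 2%:R) - u 0 (i + 2%:R) * v 0 (i + 1)).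

Definition e3 : 'rV[R]_3 := delta_mx 0 ord_max.

Lemma dotE u v :
  dot u v = u 0 0 * v 0 0 + u 0 1 * v 0 1 + u 0 2%:R * v 0 2%:R.
Proof.
rewrite /dot !big_ord_recr big_ord0 /= add0r.
by congr (_ * _ + _ * _ + _ * _); congr (_ _ _); exact: val_inj.
Qed.

Lemma cross0 u v : cross u v 0 0 = u 0 1 * v 0 2%:R - u 0 2%:R * v 0 1.
Proof. by rewrite mxE !add0r. Qed.

Lemma cross1 u v : cross u v 0 1 = u 0 2%:R * v 0 0 - u 0 0 * v 0 2%:R.
Proof.
rewrite mxE; have -> : (1 + 1 : 'I_3) = 2%:R by exact: val_inj.
by have -> : (1 + 2%:R : 'I_3) = 0 by exact: val_inj.
Qed.

Lemma cross2 u v : cross u v 0 2%:R = u 0 0 * v 0 1 - u 0 1 * v 0 0.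
Proof.
rewrite mxE; have -> : (2%:R + 1 : 'I_3) = 0 by exact: val_inj.
by have -> : (2%:R + 2%:R : 'I_3) = 1 by exact: val_inj.
Qed.

Definition crossE := (cross0, cross1, cross2).

Lemma row3P u v :
  u 0 0 = v 0 0 -> u 0 1 = v 0 1 -> u 0 2%:R = v 0 2%:R -> u = v.
Proof.
move=> h0 h1 h2; apply/rowP => -[[|[|[|//]]] i3].
- by rewrite (_ : Ordinal i3 = 0) //; exact: val_inj.
- by rewrite (_ : Ordinal i3 = 1) //; exact: val_inj.
- by rewrite (_ : Ordinal i3 = 2%:R) //; exact: val_inj.
Qed.

Lemma dot_eq0 u : dot u u = 0 -> u = 0.
Proof.
move/eqP; rewrite /dot psumr_eq0; last by move=> j _; rewrite -expr2 sqr_ge0.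
move=> /allP h0; apply/rowP => j; rewrite [RHS]mxE.
by have := h0 j (mem_index_enum _); rewrite /= -expr2 sqrf_eq0 => /eqP.
Qed.

End Euclidean.

(** * The symplectic manifold (S^2)^3 *)

(* A point (X, Y, Z) of (R^3)^3, and likewise a vector at such a point, is the
   3 x 3 matrix with rows X, Y, Z. *)

Section Manifold.
Context {R : realType}.
Implicit Types p v w : 'M[R]_3.

Definition sphere3 : set 'M[R]_3 := [set p | forall i, enorm (row i p) = 1].

Definition tangent p : {vspace 'M[R]_3} :=
  lker (linfun (fun v => \row_i dot (row i v) (row i p))).

(* On tangent vectors x \times z and y \times z this is <z, x \times y>
   (lemma omega_std_cross). *)
Definition omega_std (z u v : 'rV[R]_3) : R := dot z (cross u v).

Definition omega p v w : R := \sum_i omega_std (row i p) (row i v) (row i w).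

(* The stereographic chart of each sphere centred at the corresponding row
   of p.  Restricted to tangent p it is a parametrization of sphere3 near p
   that maps 0 to p and whose differential at 0 is the inclusion of
   tangent p. *)
Definition chart p v : 'M[R]_3 :=
  \matrix_i let q := dot (row i v) (row i v) / 4%:R in
            (1 + q)^-1 *: ((1 - q) *: row i p + row i v).

Definition differential (f : 'M[R]_3 -> R) p v : R :=
  'D_v (f \o chart p) 0.

(* The second derivative in the chart.  On tangent vectors, and at a point
   where the differential of f vanishes, it does not depend on the chart. *)
Definition hessian (f : 'M[R]_3 -> R) p v w : R :=
  'D_v (fun u => 'D_w (f \o chart p) u) 0.

(* omega^{-1}: the tangent vector x with omega(x, .) = alpha on tangent p. *)
Definition omega_inv p (alpha : 'M[R]_3 -> R) : 'M[R]_3 :=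
  xget 0 [set x | x \in tangent p /\
                  forall v, v \in tangent p -> omega p x v = alpha v].

Definition hamiltonian_vector (f : 'M[R]_3 -> R) p : 'M[R]_3 :=
  omega_inv p (differential f p).

Definition hessian_operator (f : 'M[R]_3 -> R) p (v : 'M[R]_3) : 'M[R]_3 :=
  omega_inv p (hessian f p v).

Lemma tangentP p v :
  reflect (forall i, dot (row i v) (row i p) = 0) (v \in tangent p).
Proof.
pose g v := \row_i dot (row i v) (row i p) : 'rV[R]_3.
have gl : linear g.
  move=> a x y; apply/rowP => i; rewrite !mxE /dot mulr_sumr -big_split /=.
  by apply: eq_bigr => j _; rewrite !mxE; ring.
pose gL := GRing.isLinear.Build _ _ _ _ g gl.
pose gf : {linear _ -> _} := HB.pack g gL.
rewrite memv_ker (_ : linfun _ = linfun gf) // lfunE /=.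
apply: (iffP eqP) => [/rowP h i|h]; first by have := h i; rewrite !mxE.
by apply/rowP => i; rewrite !mxE.
Qed.

Lemma sphere3P p :
  sphere3 p <-> forall i, dot (row i p) (row i p) = 1.
Proof.
split=> h i; last by rewrite /enorm h sqrtr1.
have h0 : 0 <= dot (row i p) (row i p).
  by apply: sumr_ge0 => j _; rewrite -expr2 sqr_ge0.
by rewrite -(sqr_sqrtr h0) -/(enorm _) h expr1n.
Qed.

Lemma omega_std_cross (z x y : 'rV[R]_3) : enorm z = 1 ->
  omega_std z (cross x z) (cross y z) = dot z (cross x y).
Proof.
move=> hz; have : dot z z = 1.
  have h0 : 0 <= dot z z by apply: sumr_ge0 => j _; rewrite -expr2 sqr_ge0.
  by rewrite -(sqr_sqrtr h0) -/(enorm _) hz expr1n.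
move=> zz; rewrite -[RHS]mulr1 -zz /omega_std !dotE !crossE; ring.
Qed.

Lemma chart_sphere3 p v :
  sphere3 p -> v \in tangent p -> sphere3 (chart p v).
Proof.
move=> /sphere3P pp /tangentP vp; apply/sphere3P => i; rewrite rowK.
have [{}pp {}vp] := (pp i, vp i).
move: (row i p) (row i v) pp vp => z u zz uz.
have uu : 0 <= dot u u by apply: sumr_ge0 => j _; rewrite -expr2 sqr_ge0.
cbv zeta; set q := dot u u / _.
have q0 : 1 + q != 0 by rewrite gt_eqF // ltr_pwDl // divr_ge0.
have -> a b c : dot (a *: (b *: z + u)) (c *: (b *: z + u)) =
    a * c * (b ^+ 2 * dot z z + b *+ 2 * dot u z + dot u u).
  by rewrite !dotE !mxE; ring.
have -> : dot u u = 4%:R * q by rewrite /q; field.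
by rewrite zz uz; field.
Qed.

Lemma omega_inv_eq p (alpha : 'M[R]_3 -> R) x : sphere3 p ->
  x \in tangent p -> (forall v, v \in tangent p -> omega p x v = alpha v) ->
  omega_inv p alpha = x.
Proof.
move=> /sphere3P pp xp xa; apply: xget_unique => // y [yp ya].
have /tangentP xp' := xp; have /tangentP yp' := yp.
apply/row_matrixP => i.
pose w := row i y - row i x.
pose v : 'M[R]_3 := \matrix_j if j == i then cross (row i p) w else 0.
have vp : v \in tangent p.
  apply/tangentP => j; rewrite rowK; case: eqP => [->|_].
    by rewrite !dotE !crossE; ring.
  by rewrite !dotE !mxE !mul0r !addr0.
have : omega p y v - omega p x v = 0 by rewrite ya // xa // subrr.
rewrite /omega (bigD1 i) //= [X in _ - X](bigD1 i) //=.
rewrite !big1; first last.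
- by move=> j /negPf ji; rewrite rowK ji /omega_std !dotE !crossE !mxE; ring.
- by move=> j /negPf ji; rewrite rowK ji /omega_std !dotE !crossE !mxE; ring.
rewrite rowK eqxx !addr0 => h.
have wp : dot w (row i p) = 0.
  rewrite -[RHS](subrr 0) -{1}(yp' i) -(xp' i) /w !dotE 3!mxE; rewrite !mxE; ring.
have ww : dot w w = 0.
  rewrite -[LHS]mulr1 -(pp i) -[RHS]h.
  have -> : dot w w * dot (row i p) (row i p) =
      dot w w * dot (row i p) (row i p) - dot w (row i p) ^+ 2.
    by rewrite wp expr0n subr0.
  by rewrite /w /omega_std !dotE !crossE !mxE; ring.
have := dot_eq0 ww.
by move/eqP; rewrite subr_eq0 => /eqP.
Qed.

Lemma omega_invP p (alpha : {linear 'M[R]_3 -> R^o}) : sphere3 p ->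
  omega_inv p alpha \in tangent p /\
  (forall v, v \in tangent p -> omega p (omega_inv p alpha) v = alpha v).
Proof.
move=> hp; have /sphere3P pp := hp.
pose g i : 'rV[R]_3 := \row_j alpha (delta_mx i j).
pose x : 'M[R]_3 := \matrix_i cross (g i) (row i p).
have xp : x \in tangent p.
  by apply/tangentP => i; rewrite rowK !dotE !crossE; ring.
have xa v : v \in tangent p -> omega p x v = alpha v.
  move=> /tangentP vp; rewrite [in RHS](matrix_sum_delta v) linear_sum /=.
  apply: eq_bigr => i _; rewrite linear_sum /=.
  under eq_bigr => j _ do rewrite linearZ /=.
  have -> : \sum_j v i j *: alpha (delta_mx i j) = dot (row i v) (g i).
    by apply: eq_bigr => j _; rewrite !mxE.
  rewrite rowK -[RHS]mulr1 -(pp i).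
  have -> : dot (row i v) (g i) * dot (row i p) (row i p) =
      dot (row i v) (g i) * dot (row i p) (row i p)
      - dot (row i v) (row i p) * dot (g i) (row i p).
    by rewrite (vp i) mul0r subr0.
  by rewrite /omega_std !dotE !crossE; ring.
by rewrite (omega_inv_eq hp xp xa).
Qed.

End Manifold.

(** * Cartan subalgebras of symplectic Lie algebras *)

Section Cartan.
Context {R : realType} {m : nat}.
Implicit Types (s a b : 'M[R]_m) (h : {vspace 'M[R]_m}).

Definition lie a b : 'M[R]_m := a *m b - b *m a.

(* sp of the bilinear form with Gram matrix s; endomorphisms are matrices
   acting on column vectors. *)
Definition symplectic_algebra s : set 'M[R]_m :=
  [set a | a^T *m s + s *m a = 0].

Definition lie_closed h := forall a b, a \in h -> b \in h -> lie a b \in h.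

Definition lie_product (h1 h2 : {vspace 'M[R]_m}) : {vspace 'M[R]_m} :=
  <<[seq lie a b | a <- vbasis h1, b <- vbasis h2]>>%VS.

Definition lie_nilpotent h := exists n, iter n (lie_product h) h = 0%VS.

Definition cartan_subalgebra s h :=
  [/\ forall a, a \in h -> symplectic_algebra s a,
      lie_closed h,
      lie_nilpotent h &
      forall x, symplectic_algebra s x ->
        (forall a, a \in h -> lie x a \in h) -> x \in h].

(* z lists the complex eigenvalues of a, with algebraic multiplicity. *)
Definition spectrum a (z : seq R[i]) :=
  char_poly (map_mx (real_complex R) a) = \prod_(x <- z) ('X - x%:P).

Definition elliptic_eigenvalues (B : R) : seq R[i] :=
  [:: Complex 0 B; Complex 0 (- B)].

Definition hyperbolic_eigenvalues (A : R) : seq R[i] :=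
  [:: Complex A 0; Complex (- A) 0].

Definition focus_focus_eigenvalues (A B : R) : seq R[i] :=
  [:: Complex A B; Complex A (- B); Complex (- A) B; Complex (- A) (- B)].

Definition williamson_spectrum (he hh hf : nat) (z : seq R[i]) :=
  exists (Be : 'I_he -> R) (Ah : 'I_hh -> R) (Af Bf : 'I_hf -> R),
    [/\ forall j, Be j != 0, forall j, Ah j != 0,
        forall j, Af j != 0 /\ Bf j != 0 &
        perm_eq z
          (flatten [seq elliptic_eigenvalues (Be j) | j <- enum 'I_he] ++
           flatten [seq hyperbolic_eigenvalues (Ah j) | j <- enum 'I_hh] ++
           flatten [seq focus_focus_eigenvalues (Af j) (Bf j)
                   | j <- enum 'I_hf])].

(* The generic elements are those with m distinct eigenvalues. *)
Definition algebra_williamson_type h (he hh hf : nat) :=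
  [/\ ((he + hh + hf.*2).*2 = m)%N,
      exists a z, [/\ a \in h, spectrum a z & uniq z] &
      forall a z, a \in h -> spectrum a z -> uniq z ->
        williamson_spectrum he hh hf z].

End Cartan.

(** * Critical points of a triple of functions on (S^2)^3 *)

Section CriticalPoints.
Context {R : realType}.
Implicit Types (F : 'M[R]_3 -> 'cV[R]_3) (p : 'M[R]_3) (k : nat).

Definition component F (i : 'I_3) : 'M[R]_3 -> R := fun q => F q i 0.

Definition differential_form (f : 'M[R]_3 -> R) p :
    'Hom(subvs_of (tangent p), R^o) :=
  linfun (fun v : subvs_of (tangent p) => differential f p (vsval v) : R^o).

Definition differentials F p :=
  [seq differential_form (component F i) p | i <- enum 'I_3].

Definition critical_point F p := ~~ free (differentials F p).

Definition rank F p : nat := \dim <<differentials F p>>.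

(* N is the matrix, in the basis of P / L induced by e, of the operator that B
   induces there, where P is the direct sum of L and the span of e. *)
Definition induced_matrix (L : {vspace 'M[R]_3}) m (e : m.-tuple 'M[R]_3)
    (B : 'M[R]_3 -> 'M[R]_3) (N : 'M[R]_m) :=
  (forall v, v \in L -> B v \in L) /\
  (forall j : 'I_m, B (tnth e j) - \sum_i N i j *: tnth e i \in L).

Definition gram p m (e : m.-tuple 'M[R]_3) : 'M[R]_m :=
  \matrix_(i, j) omega p (tnth e i) (tnth e j).

Definition symplectic_orthogonal p (L : {vspace 'M[R]_3}) : set 'M[R]_3 :=
  [set v | v \in tangent p /\ forall l, l \in L -> omega p v l = 0].

(* p has rank 3 - k, and h is the algebra induced on L^\perp / L by the
   operators omega^{-1} d^2 G_i (i < k), after a linear change G = A F for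
   which the differentials of the G_i with i < k vanish.  It is expressed in
   the basis of L^\perp / L induced by e, where the symplectic form has Gram
   matrix s.  Other choices of A and e only conjugate h. *)
Definition reduced_algebra F p k
    (s : 'M[R]_(k.*2)) (h : {vspace 'M[R]_(k.*2)}) :=
  exists (A : 'M[R]_3) (e : (k.*2).-tuple 'M[R]_3) (N : k.-tuple 'M[R]_(k.*2)),
    let G := fun q => A *m F q in
    let L := <<[seq hamiltonian_vector (component G i) p
               | i : 'I_3 <- enum 'I_3 & (k <= i)%N]>>%VS in
    [/\ (rank F p + k = 3)%N,
        A \in unitmx,
        forall i : 'I_3, (i < k)%N ->
          differential_form (component G i) p = 0,
        [/\ free e, (L :&: <<e>> = 0)%VS &
            forall v, symplectic_orthogonal p L v <-> v \in (L + <<e>>)%VS] &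
        [/\ forall i : 'I_3, (i < k)%N ->
              induced_matrix L e (hessian_operator (component G i) p) N`_i,
            s = gram p e &
            h = <<N>>%VS]].

Definition nondegenerate_point F p :=
  exists k (s : 'M[R]_(k.*2)) (h : {vspace 'M[R]_(k.*2)}),
    reduced_algebra F p s h /\ cartan_subalgebra s h.

Definition williamson_type F p (he hh hf : nat) :=
  exists k (s : 'M[R]_(k.*2)) (h : {vspace 'M[R]_(k.*2)}),
    [/\ reduced_algebra F p s h, cartan_subalgebra s h &
        algebra_williamson_type h he hh hf].

End CriticalPoints.

(** * The functions H, I, J *)

Section Momentum.
Context {R : realType}.
Implicit Types p : 'M[R]_3.

Definition vector_sum p : 'rV[R]_3 := \sum_i row i p.

Definition funH p : R := enorm (vector_sum p).
Definition funI p : R := dot (vector_sum p) e3.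
Definition funJ p : R := \det p.

Definition col3 (a b c : R) : 'cV[R]_3 := \col_i [:: a; b; c]`_i.

Definition momentum p : 'cV[R]_3 := col3 (funH p) (funI p) (funJ p).

End Momentum.

(* Main.v *)
Require Import Defs.
From HB Require Import structures.
From mathcomp Require Import all_boot all_order all_algebra.
From mathcomp Require Import all_classical all_reals all_analysis.
From mathcomp Require Import perm complex ring lra.

Import Order.TTheory GRing.Theory Num.Theory.
Import numFieldNormedType.Exports.

Local Open Scope ring_scope.

Set Implicit Arguments.
Unset Strict Implicit.
Unset Printing Implicit Defensive.

(** At a point (X, Y, Z) of the fibre, S = X + Y + Z is a unit vector and
    X, Y, Z are coplanar.  A linear relation between dH, dI and dJ says that
    a gradient is normal to the three spheres, that is, that three cross
    products vanish.  Their sum is a multiple of e3 x S, since H and J are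
    invariant under rotations, and e3 x S <> 0 because the height s of S is not
    1 or -1; so dI does not occur.  Coplanarity makes the remaining H and J
    terms orthogonal, hence zero, and X, Y, Z are parallel to S
    ([critical_point_parallel]).  As they add up to S, they are S, S and -S
    in some order ([parallel_rows]).

    At such a point, written as the outer product of a column of signs eps and
    the vector W = S, dH and dJ vanish and dI does not: the rank is 1.  Tangent
    vectors are triples in the plane orthogonal to W, which is a complex line
    whose multiplication by i is W x _.  The Hamiltonian vector of I is eps
    times u = e3 x W, and its symplectic orthocomplement consists of the triples
    whose sum is a real multiple of u; the triples with sum 0, a complex plane,
    are a complement of the orbit direction in it.  On this plane
    omega^{-1} d^2 H is multiplication by i ([hessian_operator_funH]), and
    omega^{-1} d^2 J acts with the real eigenvalues -1 and 1
    ([J_col_first], [J_col_second]).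

    The span of these two commuting operators is its own centralizer, and its
    own normalizer, in the symplectic algebra ([cartan_focus_algebra]), and
    a times the first plus b times the second has the eigenvalues b + ia,
    b - ia, -b + ia, -b - ia ([focus_element_spectrum]): a single focus-focus
    block. *)

(** * Derivatives of functions of one real variable at 0 *)

(** A constant of its own, so that the rules below are applied one at a time
    instead of being searched for as instances of is_derive. *)
Definition has_deriv0 (R : realType) (f : R -> R) (d : R) :=
  is_derive (0 : R) 1 f d.

Lemma has_deriv0_eq (R : realType) (f : R -> R) (d d' : R) :
  has_deriv0 f d -> d = d' -> has_deriv0 f d'.
Proof. by move=> + <-. Qed.

(** Directional derivatives of functions of a matrix only see a line, so that
    rules for functions of one real variable suffice throughout. *)
Lemma is_derive_line (R : realType) (f : 'M[R]_3 -> R) (u w : 'M[R]_3) (d : R) :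
  has_deriv0 (fun h : R => f (u + h *: w)) d -> is_derive u w f d.
Proof.
have E : (fun h : R => h^-1 *: ((f \o shift u) (h *: w) - f u)) =
    (fun h : R => h^-1 *: (((fun h : R => f (u + h *: w)) \o shift 0) (h *: 1) -
                 f (u + (0 : R) *: w))).
  apply/funext => h /=; rewrite scale0r !addr0 [h *: w + u]addrC.
  by rewrite [h *: 1]mulr1.
by case=> hd <-; split; [rewrite /derivable E|rewrite /derive E].
Qed.

Lemma has_deriv0D (R : realType) (f g : R -> R) (df dg : R) :
  has_deriv0 f df -> has_deriv0 g dg ->
  has_deriv0 (fun h => f h + g h) (df + dg).
Proof. exact: is_deriveD. Qed.

Lemma has_deriv0M (R : realType) (f g : R -> R) (df dg : R) :
  has_deriv0 f df -> has_deriv0 g dg ->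
  has_deriv0 (fun h => f h * g h) (df * g 0 + f 0 * dg).
Proof.
move=> hf hg; apply: (is_derive_eq (is_deriveM hf hg)).
by rewrite addrC mulrC.
Qed.

Lemma has_deriv0c (R : realType) (c : R) : has_deriv0 (fun=> c) 0.
Proof. exact: is_derive_cst. Qed.

Lemma has_deriv0id (R : realType) : has_deriv0 (fun h : R => h) 1.
Proof. exact: is_derive_id. Qed.

Lemma has_deriv0V (R : realType) (f : R -> R) (df : R) :
  f 0 != 0 -> has_deriv0 f df ->
  has_deriv0 (fun h => (f h)^-1) (- (df / f 0 ^+ 2)).
Proof.
move=> f0 [hf <-]; split; first exact: derivableV.
by rewrite deriveV // scaleNr /GRing.scale /= mulrC.
Qed.

Lemma has_deriv0_sqrt (R : realType) (f : R -> R) (df : R) :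
  0 < f 0 -> has_deriv0 f df ->
  has_deriv0 (fun h => Num.sqrt (f h)) (df / (2 * Num.sqrt (f 0))).
Proof.
move=> f0 hf; apply: is_derive_eq; first exact: is_derive1_comp (is_derive1_sqrt f0) hf.
by rewrite mulrC.
Qed.

(** * The stereographic chart to first order *)

(** Taken entry by entry, which reduces curves of vectors to real functions. *)
Definition velocity (R : realType) (c : R -> 'rV[R]_3) (d : 'rV[R]_3) :=
  forall j, has_deriv0 (fun h => c h 0 j) (d 0 j).

Lemma velocity_eq (R : realType) (c c' : R -> 'rV[R]_3) (d d' : 'rV[R]_3) :
  velocity c d -> c =1 c' -> d = d' -> velocity c' d'.
Proof. by move=> hc /funext <- <-. Qed.

Lemma velocity_line (R : realType) (x y : 'rV[R]_3) :
  velocity (fun h => x + h *: y) y.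
Proof.
move=> j; under eq_fun do rewrite !mxE.
apply: has_deriv0_eq.
  apply: has_deriv0D; first exact: has_deriv0c.
  by apply: has_deriv0M; [exact: has_deriv0id|exact: has_deriv0c].
by rewrite add0r mul1r mul0r addr0.
Qed.

Lemma velocity_cst (R : realType) (x : 'rV[R]_3) : velocity (fun=> x) 0.
Proof. by move=> j; rewrite mxE; exact: has_deriv0c. Qed.

Lemma velocityD (R : realType) (c1 c2 : R -> 'rV[R]_3) (d1 d2 : 'rV[R]_3) :
  velocity c1 d1 -> velocity c2 d2 ->
  velocity (fun h => c1 h + c2 h) (d1 + d2).
Proof.
move=> h1 h2 j; under eq_fun do rewrite !mxE.
by rewrite mxE; exact: has_deriv0D.
Qed.

Lemma velocityZ (R : realType) (a : R -> R) (da : R) (c : R -> 'rV[R]_3)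
    (d : 'rV[R]_3) : has_deriv0 a da -> velocity c d ->
  velocity (fun h => a h *: c h) (da *: c 0 + a 0 *: d).
Proof.
move=> ha hc j; under eq_fun do rewrite !mxE.
by rewrite !mxE; exact: has_deriv0M.
Qed.

Lemma velocity_dot (R : realType) (c1 c2 : R -> 'rV[R]_3) (d1 d2 : 'rV[R]_3) :
  velocity c1 d1 -> velocity c2 d2 ->
  has_deriv0 (fun h => dot (c1 h) (c2 h))
    (dot d1 (c2 0) + dot (c1 0) d2).
Proof.
move=> h1 h2; under eq_fun do rewrite dotE.
apply: has_deriv0_eq; first by do 2?apply: has_deriv0D; apply: has_deriv0M.
by rewrite !dotE; ring.
Qed.

Lemma velocity_cross (R : realType) (c1 c2 : R -> 'rV[R]_3)
    (d1 d2 : 'rV[R]_3) : velocity c1 d1 -> velocity c2 d2 ->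
  velocity (fun h => cross (c1 h) (c2 h)) (cross d1 (c2 0) + cross (c1 0) d2).
Proof.
move=> h1 h2 j; under eq_fun do rewrite mxE -mulN1r.
apply: has_deriv0_eq.
  apply: has_deriv0D; first exact: has_deriv0M.
  by apply: has_deriv0M; [exact: has_deriv0c|exact: has_deriv0M].
by rewrite !mxE; ring.
Qed.

(** The determinant with rows x, y, z (lemma [det_volume]). *)
Definition volume (R : realType) (x y z : 'rV[R]_3) : R := dot x (cross y z).

Lemma velocity_volume (R : realType) (c1 c2 c3 : R -> 'rV[R]_3)
    (d1 d2 d3 : 'rV[R]_3) : velocity c1 d1 -> velocity c2 d2 -> velocity c3 d3 ->
  has_deriv0 (fun h => volume (c1 h) (c2 h) (c3 h))
    (volume d1 (c2 0) (c3 0) + volume (c1 0) d2 (c3 0) + volume (c1 0) (c2 0) d3).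
Proof.
move=> h1 h2 h3; apply: has_deriv0_eq.
  by apply: velocity_dot => //; exact: velocity_cross.
by rewrite /volume !dotE !mxE; ring.
Qed.

Lemma det_volume (R : realType) (p : 'M[R]_3) :
  \det p = volume (row 0 p) (row 1 p) (row 2%:R p).
Proof.
rewrite (expand_det_row _ (0 : 'I_3)) !big_ord_recl big_ord0 /cofactor.
rewrite !(expand_det_row _ (0 : 'I_2)) !big_ord_recl !big_ord0 /cofactor !det_mx11.
rewrite !mxE /volume dotE !crossE !mxE /=.
(* Entries are read at natural numbers, so that the lifted indices compute. *)
have [P PE] : exists P : nat -> nat -> R, forall i j, p i j = P i j.
  by exists (fun i j => p (inord i) (inord j)) => i j; rewrite !inord_val.
rewrite !PE /= /bump /=; ring.
Qed.

(** The derivative of chart p at u in the direction w, by the product rule: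
    the scalars q and dq are |u_i|^2 / 4 and its derivative. *)
Definition dchart (R : realType) (p u w : 'M[R]_3) : 'M[R]_3 :=
  \matrix_i let q := dot (row i u) (row i u) / 4%:R in
            let dq := dot (row i u) (row i w) / 2%:R in
            (1 + q)^-1 *: (row i w - dq *: row i p)
            - (dq / (1 + q) ^+ 2) *: ((1 - q) *: row i p + row i u).

Lemma dot_ge0 (R : realType) (u : 'rV[R]_3) : 0 <= dot u u.
Proof. by apply: sumr_ge0 => j _; rewrite -expr2 sqr_ge0. Qed.

Lemma chart_denominator_neq0 (R : realType) (u : 'rV[R]_3) :
  1 + dot u u / 4%:R != 0.
Proof. by rewrite gt_eqF // ltr_pwDl // divr_ge0 // dot_ge0. Qed.

(** The factor a is 1 or -1, for the denominator 1 + q and the numerator 1 - q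
    of the chart. *)
Lemma has_deriv0_radius (R : realType) (x y : 'rV[R]_3) (a : R) :
  has_deriv0 (fun h => a * (dot (x + h *: y) (x + h *: y) / 4%:R))
             (a * (dot x y / 2%:R)).
Proof.
apply: has_deriv0_eq.
  apply: has_deriv0M; first exact: has_deriv0c.
  apply: has_deriv0M; last exact: has_deriv0c.
  by apply: velocity_dot; exact: velocity_line.
by rewrite !dotE !mxE; field.
Qed.

Lemma velocity_chart (R : realType) (p u w : 'M[R]_3) (i : 'I_3) :
  velocity (fun h => row i (chart p (u + h *: w))) (row i (dchart p u w)).
Proof.
have rE h : row i (u + h *: w) = row i u + h *: row i w.
  by apply/rowP => j; rewrite !mxE.
have d1 := has_deriv0_radius (row i u) (row i w) 1.
have dN := has_deriv0_radius (row i u) (row i w) (-1).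
apply: velocity_eq.
- apply: velocityZ.
    apply: has_deriv0V; last first.
      by apply: has_deriv0D; [exact: (has_deriv0c 1)|exact: d1].
    by rewrite /= scale0r addr0 mul1r; exact: chart_denominator_neq0.
  apply: velocityD; last exact: (velocity_line (row i u) (row i w)).
  apply: velocityZ; last exact: (velocity_cst (row i p)).
  by apply: has_deriv0D; [exact: (has_deriv0c 1)|exact: dN].
- by move=> h; rewrite rowK rE mul1r mulN1r.
- rewrite rowK !scale0r !scaler0 !addr0 !add0r !mul1r !mulN1r.
  by apply/rowP => j; rewrite !mxE; ring.
Qed.

(** * Differentials of H, I and J *)

Lemma vector_sumE (R : realType) (p : 'M[R]_3) :
  vector_sum p = row 0 p + row 1 p + row 2%:R p.
Proof.
rewrite /vector_sum !big_ord_recr big_ord0 /= add0r.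
by congr (_ + _ + _); congr row; exact: val_inj.
Qed.

Lemma velocity_vector_sum (R : realType) (c : R -> 'M[R]_3) (d : 'M[R]_3) :
  (forall i, velocity (fun h => row i (c h)) (row i d)) ->
  velocity (fun h => vector_sum (c h)) (vector_sum d).
Proof.
move=> hc; apply: velocity_eq.
- by apply: velocityD; [apply: velocityD|].
- by move=> h /=; rewrite vector_sumE.
- by rewrite vector_sumE.
Qed.

Lemma has_deriv0_funH (R : realType) (c : R -> 'M[R]_3) (d : 'M[R]_3) :
  0 < dot (vector_sum (c 0)) (vector_sum (c 0)) ->
  (forall i, velocity (fun h => row i (c h)) (row i d)) ->
  has_deriv0 (fun h => funH (c h))
    (dot (vector_sum (c 0)) (vector_sum d) / funH (c 0)).
Proof.
move=> S0 /velocity_vector_sum hc; have hS := velocity_dot hc hc.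
apply: has_deriv0_eq; first exact: has_deriv0_sqrt S0 hS.
have : funH (c 0) != 0 by rewrite /funH /enorm gt_eqF // sqrtr_gt0.
rewrite -/(enorm _) -/(funH _) /= !dotE => h; field.
by rewrite h.
Qed.

(** The derivative of the determinant at p in the direction x. *)
Definition cyclic_volume (R : realType) (x p : 'M[R]_3) : R :=
  volume (row 0 x) (row 1 p) (row 2%:R p)
  + volume (row 0 p) (row 1 x) (row 2%:R p)
  + volume (row 0 p) (row 1 p) (row 2%:R x).

Lemma has_deriv0_funJ (R : realType) (c : R -> 'M[R]_3) (d : 'M[R]_3) :
  (forall i, velocity (fun h => row i (c h)) (row i d)) ->
  has_deriv0 (fun h => funJ (c h)) (cyclic_volume d (c 0)).
Proof.
move=> hc; rewrite /funJ; under eq_fun do rewrite det_volume.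
exact: velocity_volume.
Qed.

Lemma has_deriv0_funI (R : realType) (c : R -> 'M[R]_3) (d : 'M[R]_3) :
  (forall i, velocity (fun h => row i (c h)) (row i d)) ->
  has_deriv0 (fun h => funI (c h)) (dot (vector_sum d) e3).
Proof.
move=> hc; apply: has_deriv0_eq.
  apply: velocity_dot; first exact: velocity_vector_sum hc.
  exact: (velocity_cst e3).
by rewrite !dotE !mxE; ring.
Qed.

Lemma chart0 (R : realType) (p : 'M[R]_3) : chart p 0 = p.
Proof.
apply/row_matrixP => i; rewrite rowK row0 /=.
have -> : dot (0 : 'rV[R]_3) 0 = 0 by rewrite dotE !mxE !mulr0 !addr0.
by rewrite mul0r addr0 invr1 subr0 !scale1r addr0.
Qed.

Lemma dchart0 (R : realType) (p w : 'M[R]_3) : dchart p 0 w = w.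
Proof.
apply/row_matrixP => i; rewrite rowK row0 /=.
have d0 x : dot (0 : 'rV[R]_3) x = 0 by rewrite dotE !mxE !mul0r !addr0.
by rewrite !d0 !mul0r addr0 invr1 scale0r !subr0 scale1r scale0r subr0.
Qed.

Lemma derive_funH (R : realType) (p u w : 'M[R]_3) :
  0 < dot (vector_sum (chart p u)) (vector_sum (chart p u)) ->
  'D_w (@funH R \o chart p) u =
  dot (vector_sum (chart p u)) (vector_sum (dchart p u w)) / funH (chart p u).
Proof.
move=> S0; apply: derive_val; apply: is_derive_line.
have := @has_deriv0_funH _ (fun h => chart p (u + h *: w)) (dchart p u w).
by rewrite /= scale0r addr0; apply => // i; exact: velocity_chart.
Qed.

Lemma derive_funJ (R : realType) (p u w : 'M[R]_3) :
  'D_w (@funJ R \o chart p) u = cyclic_volume (dchart p u w) (chart p u).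
Proof.
apply: derive_val; apply: is_derive_line.
have := @has_deriv0_funJ _ (fun h => chart p (u + h *: w)) (dchart p u w).
by rewrite /= scale0r addr0; apply => // i; exact: velocity_chart.
Qed.

Lemma derive_funI (R : realType) (p u w : 'M[R]_3) :
  'D_w (@funI R \o chart p) u = dot (vector_sum (dchart p u w)) e3.
Proof.
apply: derive_val; apply: is_derive_line.
have := @has_deriv0_funI _ (fun h => chart p (u + h *: w)) (dchart p u w).
by apply => // i; exact: velocity_chart.
Qed.

Lemma differential_funH (R : realType) (p v : 'M[R]_3) : funH p = 1 ->
  differential (@funH R) p v = dot (vector_sum p) (vector_sum v).
Proof.
move=> H1; rewrite /differential derive_funH ?chart0 ?dchart0 ?H1 ?divr1 //.
by rewrite -sqrtr_gt0 -/(enorm _) -/(funH _) H1.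
Qed.

Lemma differential_funJ (R : realType) (p v : 'M[R]_3) :
  differential (@funJ R) p v = cyclic_volume v p.
Proof. by rewrite /differential derive_funJ chart0 dchart0. Qed.

Lemma differential_funI (R : realType) (p v : 'M[R]_3) :
  differential (@funI R) p v = dot (vector_sum v) e3.
Proof. by rewrite /differential derive_funI dchart0. Qed.

(** The mixed second derivative at 0 of the stereographic chart: it is normal to
    the spheres. *)
Definition sphere_acceleration (R : realType) (p v w : 'M[R]_3) : 'M[R]_3 :=
  \matrix_i (- dot (row i v) (row i w) *: row i p).

Lemma velocity_dchart (R : realType) (p v w : 'M[R]_3) (i : 'I_3) :
  velocity (fun h => row i (dchart p (0 + h *: v) w))
    (row i (sphere_acceleration p v w)).
Proof.
have rE (h : R) : row i (0 + h *: v) = 0 + h *: row i v.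
  by apply/rowP => j; rewrite !mxE.
have d1 := has_deriv0_radius 0 (row i v) 1.
have dN := has_deriv0_radius 0 (row i v) (-1).
have dinv : has_deriv0
   (fun h => (1 + 1 * (dot (0 + h *: row i v) (0 + h *: row i v) / 4%:R))^-1) 0.
  apply: has_deriv0_eq.
    apply: has_deriv0V; last first.
      by apply: has_deriv0D; [exact: (has_deriv0c 1)|exact: d1].
    by rewrite /= scale0r addr0 mul1r; exact: chart_denominator_neq0.
  by rewrite dotE !mxE /=; ring.
have ddq (a : R) : has_deriv0
   (fun h => a * (dot (0 + h *: row i v) (row i w) / 2%:R))
   (a * (dot (row i v) (row i w) / 2%:R)).
  apply: has_deriv0_eq.
    apply: has_deriv0M; first exact: has_deriv0c.
    apply: has_deriv0M; last exact: has_deriv0c.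
    apply: velocity_dot; first exact: velocity_line.
    exact: (velocity_cst (row i w)).
  by rewrite !dotE !mxE; field.
apply: velocity_eq.
- apply: velocityD.
    apply: velocityZ; first exact: dinv.
    apply: velocityD; first exact: (velocity_cst (row i w)).
    apply: velocityZ; first exact: (ddq (-1)).
    exact: (velocity_cst (row i p)).
  apply: velocityZ.
    apply: has_deriv0M; first exact: (ddq (-1)).
    by apply: has_deriv0M; [exact: dinv|exact: dinv].
  apply: velocityD.
    apply: velocityZ; last exact: (velocity_cst (row i p)).
    by apply: has_deriv0D; [exact: (has_deriv0c 1)|exact: dN].
  exact: (velocity_line 0 (row i v)).
- move=> h; rewrite rowK /= rE !mul1r !mulN1r expr2 invfM.
  by rewrite !scaleNr mulNr scaleNr.
- rewrite rowK !scale0r !scaler0 !addr0 !add0r.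
  have d0 x : dot (0 : 'rV[R]_3) x = 0 by rewrite dotE !mxE !mul0r !addr0.
  rewrite !d0; by apply/rowP => j; rewrite !mxE; field.
Qed.

(** * Hessians of H and J *)

(** The first derivative need only be known near 0, which matters for H, whose
    formula is valid only away from the zeros of H. *)
Lemma hessian_along_line (R : realType) (f : 'M[R]_3 -> R) (p v w : 'M[R]_3)
    (g : R -> R) (d : R) :
  (\forall h \near (0 : R), g h = 'D_w (f \o chart p) (0 + h *: v)) ->
  has_deriv0 g d -> hessian f p v w = d.
Proof.
move=> gE hg; apply: derive_val; apply: is_derive_line.
exact: near_eq_is_derive gE hg.
Qed.

Lemma velocity_chart0 (R : realType) (p v : 'M[R]_3) (i : 'I_3) :
  velocity (fun h => row i (chart p (0 + h *: v))) (row i v).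
Proof. by rewrite -{2}(dchart0 p v); exact: velocity_chart. Qed.

Lemma has_deriv0_near_gt0 (R : realType) (f : R -> R) (d : R) :
  has_deriv0 f d -> 0 < f 0 -> \forall h \near (0 : R), 0 < f h.
Proof.
move=> [/derivable1_diffP/differentiable_continuous fc _] f0.
exact: (cvgr_gt (f 0) fc 0 f0).
Qed.

(** The first summand comes from the curvature of the spheres, the others from
    the second derivative of the trilinear determinant. *)
Lemma hessian_funJ (R : realType) (p v w : 'M[R]_3) :
  hessian (@funJ R) p v w =
  cyclic_volume (sphere_acceleration p v w) p +
  (volume (row 0 w) (row 1 v) (row 2%:R p) + volume (row 0 w) (row 1 p) (row 2%:R v)
 + (volume (row 0 v) (row 1 w) (row 2%:R p) + volume (row 0 p) (row 1 w) (row 2%:R v))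
 + (volume (row 0 v) (row 1 p) (row 2%:R w) + volume (row 0 p) (row 1 v) (row 2%:R w))).
Proof.
pose c h := chart p (0 + h *: v); pose dc h := dchart p (0 + h *: v) w.
have gE : \forall h \near (0 : R),
    cyclic_volume (dc h) (c h) = 'D_w (@funJ R \o chart p) (0 + h *: v).
  by apply: filterE => h; rewrite derive_funJ.
apply: (hessian_along_line gE).
have c0 : c 0 = p by rewrite /c scale0r addr0 chart0.
have dc0 : dc 0 = w by rewrite /dc scale0r addr0 dchart0.
have hc i : velocity (fun h => row i (c h)) (row i v) by exact: velocity_chart0.
have hdc i : velocity (fun h => row i (dc h)) (row i (sphere_acceleration p v w)).
  exact: velocity_dchart.
apply: has_deriv0_eq.
  apply: has_deriv0D; first apply: has_deriv0D.
  - exact: velocity_volume (hdc 0) (hc 1) (hc 2%:R).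
  - exact: velocity_volume (hc 0) (hdc 1) (hc 2%:R).
  - exact: velocity_volume (hc 0) (hc 1) (hdc 2%:R).
rewrite /= c0 dc0 /cyclic_volume; ring.
Qed.

(** The second summand comes from the curvature of the spheres, the last one
    from the square root. *)
Lemma hessian_funH (R : realType) (p v w : 'M[R]_3) : funH p = 1 ->
  hessian (@funH R) p v w =
  dot (vector_sum v) (vector_sum w)
  + dot (vector_sum p) (vector_sum (sphere_acceleration p v w))
  - dot (vector_sum p) (vector_sum v) * dot (vector_sum p) (vector_sum w).
Proof.
move=> H1.
pose c h := chart p (0 + h *: v); pose dc h := dchart p (0 + h *: v) w.
have c0 : c 0 = p by rewrite /c scale0r addr0 chart0.
have dc0 : dc 0 = w by rewrite /dc scale0r addr0 dchart0.
have hc i : velocity (fun h => row i (c h)) (row i v) by exact: velocity_chart0.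
have hdc i : velocity (fun h => row i (dc h)) (row i (sphere_acceleration p v w)).
  exact: velocity_dchart.
have hS := velocity_vector_sum hc; have hdS := velocity_vector_sum hdc.
have S0 : 0 < dot (vector_sum (c 0)) (vector_sum (c 0)).
  by rewrite c0 -sqrtr_gt0 -/(enorm _) -/(funH _) H1.
have gE : \forall h \near (0 : R),
    dot (vector_sum (c h)) (vector_sum (dc h)) * (funH (c h))^-1 =
    'D_w (@funH R \o chart p) (0 + h *: v).
  apply: filterS (has_deriv0_near_gt0 (velocity_dot hS hS) S0) => h Sh.
  by rewrite derive_funH.
apply: (hessian_along_line gE).
apply: has_deriv0_eq.
  apply: has_deriv0M; first exact: velocity_dot hS hdS.
  apply: has_deriv0V; last exact: has_deriv0_funH S0 hc.
  by rewrite c0 H1 oner_neq0.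
by rewrite /= c0 dc0 H1 expr1n !invr1 !mulr1 mulrN [_ * dot _ (vector_sum v)]mulrC.
Qed.

(** * Linear relations between the differentials *)

Lemma ord3_ind (P : 'I_3 -> Prop) : P 0 -> P 1 -> P 2%:R -> forall i, P i.
Proof.
move=> h0 h1 h2 [[|[|[|//]]] i3].
- by rewrite (_ : Ordinal i3 = 0) //; exact: val_inj.
- by rewrite (_ : Ordinal i3 = 1) //; exact: val_inj.
- by rewrite (_ : Ordinal i3 = 2%:R) //; exact: val_inj.
Qed.

Lemma sum_ord3 (V : nmodType) (f : 'I_3 -> V) :
  \sum_i f i = f 0 + f 1 + f 2%:R.
Proof.
rewrite !big_ord_recr big_ord0 /= add0r.
by congr (_ + _ + _); congr f; exact: val_inj.
Qed.

Lemma ord3_add11 : 1 + 1 = 2%:R :> 'I_3. Proof. exact: val_inj. Qed.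
Lemma ord3_add12 : 1 + 2%:R = 0 :> 'I_3. Proof. exact: val_inj. Qed.
Lemma ord3_add21 : 2%:R + 1 = 0 :> 'I_3. Proof. exact: val_inj. Qed.
Lemma ord3_add22 : 2%:R + 2%:R = 1 :> 'I_3. Proof. exact: val_inj. Qed.
Definition ord3E :=
  (add0r (1 : 'I_3), add0r (2%:R : 'I_3),
   ord3_add11, ord3_add12, ord3_add21, ord3_add22).

(** A gradient that vanishes on all tangent vectors is normal to each sphere.
    It is tested on its own tangential part. *)
Lemma cross_gradient_eq0 (R : realType) (p g : 'M[R]_3) :
  (forall v, v \in tangent p -> \sum_i dot (row i g) (row i v) = 0) ->
  forall i, cross (row i g) (row i p) = 0.
Proof.
move=> hg i.
pose v : 'M[R]_3 := \matrix_i cross (row i p) (cross (row i g) (row i p)).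
have vp : v \in tangent p.
  by apply/tangentP => j; rewrite rowK !dotE !crossE; ring.
have := hg v vp.
have -> : \sum_j dot (row j g) (row j v) =
    \sum_j dot (cross (row j g) (row j p)) (cross (row j g) (row j p)).
  by apply: eq_bigr => j _; rewrite rowK !dotE !crossE; ring.
move/eqP; rewrite psumr_eq0; last by move=> j _; exact: dot_ge0.
by move=> /allP /(_ i (mem_index_enum _)) /eqP /dot_eq0.
Qed.

Section Critical.
Variables (R : realType) (p : 'M[R]_3) (a b c : R).
Let S := vector_sum p.
Let n i := cross (row (i + 1) p) (row (i + 2%:R) p).

Hypothesis p_sphere : sphere3 p.
Hypothesis p_coplanar : \det p = 0.
Hypothesis S_e3 : cross e3 S != 0.
Hypothesis relation : forall v, v \in tangent p ->
  a * dot S (vector_sum v) + b * dot (vector_sum v) e3 + c * cyclic_volume v p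
  = 0.

(** The gradients of the three terms of the relation have the rows S, e3 and
    n i. *)
Lemma cross_relation i :
  a *: cross S (row i p) + b *: cross e3 (row i p) + c *: cross (n i) (row i p)
  = 0.
Proof.
pose g : 'M[R]_3 := \matrix_i (a *: S + b *: e3 + c *: n i).
rewrite -(@cross_gradient_eq0 _ p g _ i).
  by rewrite rowK; apply/rowP => j; rewrite !mxE; ring.
move=> v /relation rel; rewrite -[RHS]rel sum_ord3 !rowK /n !ord3E vector_sumE.
rewrite /cyclic_volume /volume.
move: S e3 (row 0 v) (row 1 v) (row 2%:R v) => s e x y z.
move: (row 0 p) (row 1 p) (row 2%:R p) => x' y' z'.
by rewrite !dotE !mxE !ord3E; ring.
Qed.

(** In the sum over i of the cross relations the H terms add up to S x S and the
    J terms cancel by the Jacobi identity: H and J are rotation invariant. *)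
Lemma relation_I : b = 0.
Proof.
have : b *: cross e3 S = 0.
  have -> : b *: cross e3 S = \sum_i (a *: cross S (row i p) +
     b *: cross e3 (row i p) + c *: cross (n i) (row i p)).
    rewrite sum_ord3 /n /S !vector_sumE !ord3E.
    move: e3 (row 0 p) (row 1 p) (row 2%:R p) => e x y z.
    by apply: row3P; rewrite !mxE !ord3E; ring.
  by apply: big1 => i _; exact: cross_relation.
by move/eqP; rewrite scaler_eq0 (negPf S_e3) orbF => /eqP.
Qed.

Lemma volume_normal i : dot (row i p) (n i) = 0.
Proof.
rewrite -p_coplanar det_volume /n /volume.
by elim/ord3_ind: i; rewrite !ord3E // !dotE !crossE; ring.
Qed.

Lemma dot_sum_normal i : dot S (n i) = 0.
Proof.
rewrite -p_coplanar det_volume /n /S vector_sumE /volume.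
by elim/ord3_ind: i; rewrite !ord3E !dotE !crossE !mxE; ring.
Qed.

(** The vector S x p_i is normal to the plane of the rows of p, and
    (n i) x p_i lies in it, so that the two terms of the relation are
    orthogonal. *)
Lemma cross_relation_split i :
  a *: cross S (row i p) = 0 /\ c *: cross (n i) (row i p) = 0.
Proof.
have := cross_relation i; rewrite relation_I scale0r addr0.
set x := _ *: _; set y := _ *: _ => xy.
have dxy : dot x y = 0.
  (* The Lagrange identity for the two cross products with row i p. *)
  transitivity (a * c * (dot S (n i) * dot (row i p) (row i p)
      - dot S (row i p) * dot (row i p) (n i))).
    by rewrite /x /y !dotE !mxE !ord3E; ring.
  by rewrite dot_sum_normal volume_normal mul0r mulr0 subr0 mulr0.
have yx : y = - x by apply/eqP; rewrite -addr_eq0 addrC xy.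
suff x0 : x = 0 by rewrite yx x0 oppr0.
apply: dot_eq0; apply: oppr_inj; rewrite oppr0 -dxy yx.
by rewrite !dotE !mxE; ring.
Qed.

(** If the J term occurs, each n i is both parallel and orthogonal to p_i, hence
    zero, and S x p_i is a difference of two such n j. *)
Lemma relation_trivial_or_parallel :
  (a = 0 /\ c = 0) \/ forall i, cross S (row i p) = 0.
Proof.
have [a0|a0] := eqVneq a 0; last first.
  right=> i; have [/eqP + _] := cross_relation_split i.
  by rewrite scaler_eq0 (negPf a0) => /eqP.
have [c0|c0] := eqVneq c 0; first by left.
right; have n0 i : n i = 0.
  have [_ /eqP] := cross_relation_split i.
  rewrite scaler_eq0 (negPf c0) => /eqP nx.
  apply: dot_eq0; rewrite -[LHS]mulr1; have /sphere3P/(_ i) <- := p_sphere.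
  (* The Lagrange identity again, with row i p of norm 1. *)
  transitivity (dot (cross (n i) (row i p)) (cross (n i) (row i p))
                + dot (row i p) (n i) ^+ 2).
    by rewrite !dotE !crossE; ring.
  by rewrite nx volume_normal !dotE !mxE; ring.
rewrite /S vector_sumE; elim/ord3_ind.
- transitivity (n 1 - n 2%:R); last by rewrite !n0 subrr.
  by rewrite /n !ord3E; apply: row3P; rewrite !mxE !ord3E; ring.
- transitivity (n 2%:R - n 0); last by rewrite !n0 subrr.
  by rewrite /n !ord3E; apply: row3P; rewrite !mxE !ord3E; ring.
- transitivity (n 0 - n 1); last by rewrite !n0 subrr.
  by rewrite /n !ord3E; apply: row3P; rewrite !mxE !ord3E; ring.
Qed.

End Critical.

(** * Critical points in the fibre have parallel rows *)

Lemma enum_ord3 : enum 'I_3 = [:: 0; 1; 2%:R].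
Proof. by apply: (inj_map val_inj); rewrite val_enum_ord. Qed.

Lemma vector_sum_linear (R : realType) (a : R) (v w : 'M[R]_3) :
  vector_sum (a *: v + w) = a *: vector_sum v + vector_sum w.
Proof. by rewrite !vector_sumE; apply/rowP => j; rewrite !mxE; ring. Qed.

Lemma dot_linear_r (R : realType) (x : 'rV[R]_3) (a : R) (v w : 'rV[R]_3) :
  dot x (a *: v + w) = a * dot x v + dot x w.
Proof. by rewrite !dotE !mxE; ring. Qed.

Lemma dot_linear_l (R : realType) (x : 'rV[R]_3) (a : R) (v w : 'rV[R]_3) :
  dot (a *: v + w) x = a * dot v x + dot w x.
Proof. by rewrite !dotE !mxE; ring. Qed.

Lemma cyclic_volume_linear (R : realType) (p : 'M[R]_3) (a : R) (v w : 'M[R]_3) :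
  cyclic_volume (a *: v + w) p = a * cyclic_volume v p + cyclic_volume w p.
Proof. by rewrite /cyclic_volume /volume !dotE !crossE !mxE; ring. Qed.

(** The function linfun is only meaningful on linear functions, whence the
    linearity hypothesis. *)
Lemma differential_formE (R : realType) (f : 'M[R]_3 -> R) (p v : 'M[R]_3) :
  (forall a x y, differential f p (a *: x + y) =
                 a * differential f p x + differential f p y) ->
  v \in tangent p ->
  differential_form f p (vsproj (tangent p) v) = differential f p v.
Proof.
move=> fl vp.
pose g (u : subvs_of (tangent p)) := differential f p (vsval u) : R^o.
have gl : linear g by move=> a x y; rewrite /g linearP fl.
pose gL := GRing.isLinear.Build _ _ _ _ g gl.
pose gf : {linear _ -> _} := HB.pack g gL.
rewrite /differential_form (_ : linfun _ = linfun gf) // lfunE /=.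
by rewrite /g vsprojK.
Qed.

Lemma component_momentum0 (R : realType) : component (@momentum R) 0 = @funH R.
Proof. by apply/funext => q; rewrite /component /momentum mxE. Qed.

Lemma component_momentum1 (R : realType) : component (@momentum R) 1 = @funI R.
Proof. by apply/funext => q; rewrite /component /momentum mxE. Qed.

Lemma component_momentum2 (R : realType) :
  component (@momentum R) 2%:R = @funJ R.
Proof. by apply/funext => q; rewrite /component /momentum mxE. Qed.

Lemma differentials_momentum (R : realType) (p : 'M[R]_3) :
  differentials (@momentum R) p =
  [:: differential_form (@funH R) p; differential_form (@funI R) p;
      differential_form (@funJ R) p].
Proof.
rewrite /differentials enum_ord3 /= component_momentum0 component_momentum1.
by rewrite component_momentum2.
Qed.

Lemma e3E (R : realType) :
  ((e3 : 'rV[R]_3) 0 0 = 0)%R * ((e3 : 'rV[R]_3) 0 1 = 0)%R *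
  ((e3 : 'rV[R]_3) 0 2%:R = 1)%R.
Proof. by rewrite !mxE. Qed.

Lemma dot_cross_e3 (R : realType) (x : 'rV[R]_3) :
  dot (cross e3 x) (cross e3 x) = dot x x - dot x e3 ^+ 2.
Proof. by rewrite !dotE !crossE !e3E; ring. Qed.

Lemma one_sub_sqr_gt0 (R : realType) (s : R) : -1 < s < 1 -> 0 < 1 - s ^+ 2.
Proof. by move=> /andP[s1 s2]; nra. Qed.

Lemma funH_eq1 (R : realType) (p : 'M[R]_3) :
  funH p = 1 -> dot (vector_sum p) (vector_sum p) = 1.
Proof.
by move=> H1; rewrite -(sqr_sqrtr (dot_ge0 _)) -/(enorm _) -/(funH _) H1 expr1n.
Qed.

(** If the rows are not all parallel to their sum, every linear relation between
    the differentials is trivial, so that they are free. *)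
Lemma critical_point_parallel (R : realType) (p : 'M[R]_3) :
  sphere3 p -> critical_point momentum p ->
  funH p = 1 -> -1 < funI p < 1 -> funJ p = 0 ->
  forall i, cross (vector_sum p) (row i p) = 0.
Proof.
move=> pS crit H1 I1 J0.
have SS := funH_eq1 H1.
have Se3 : cross e3 (vector_sum p) != 0.
  apply/eqP => e0; have := one_sub_sqr_gt0 I1.
  by rewrite -SS -dot_cross_e3 e0 dotE !mxE !mulr0 !addr0 ltxx.
apply: contrapT => np; move: crit.
rewrite /critical_point differentials_momentum => /negP; apply.
apply/(@freeP _ _ 3 [tuple of [:: _; _; _]]) => k.
rewrite sum_ord3 /= => k0.
have rel v : v \in tangent p ->
    k 0 * dot (vector_sum p) (vector_sum v) + k 1 * dot (vector_sum v) e3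
    + k 2%:R * cyclic_volume v p = 0.
  move=> vp; have /(congr1 (fun f => fun_of_lfun f (vsproj (tangent p) v))) := k0.
  rewrite !add_lfunE !scale_lfunE !differential_formE //.
  - rewrite differential_funH // differential_funI differential_funJ.
    by rewrite zero_lfunE.
  - by move=> a x y; rewrite !differential_funJ cyclic_volume_linear.
  - by move=> a x y; rewrite !differential_funI vector_sum_linear dot_linear_l.
  - by move=> a x y; rewrite !differential_funH // vector_sum_linear dot_linear_r.
have k1 := relation_I Se3 rel.
have [[kH kJ]|//] := relation_trivial_or_parallel pS J0 Se3 rel.
by elim/ord3_ind.
Qed.

(** * The points with rows W, W and -W *)

(** The coefficients of the rows of a critical point on their sum: one row, of
    index m, is opposite to the other two. *)
Definition sign_col (R : realType) (m : 'I_3) : 'cV[R]_3 :=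
  \col_i (if i == m then -1 else 1).

Lemma sign_colE (R : realType) (e0 e1 e2 : R) :
  e0 ^+ 2 = 1 -> e1 ^+ 2 = 1 -> e2 ^+ 2 = 1 -> e0 + e1 + e2 = 1 ->
  exists m : 'I_3, [/\ e0 = sign_col R m 0 0, e1 = sign_col R m 1 0 &
                       e2 = sign_col R m 2%:R 0].
Proof.
have sgn (x : R) : x ^+ 2 = 1 -> x = 1 \/ x = -1.
  by move=> /eqP; rewrite sqrf_eq1 => /orP[] /eqP ->; [left|right].
move=> /sgn h0 /sgn h1 /sgn h2 s.
by case: h0 h1 h2 s => -> [] -> [] -> s; try lra;
  [exists 2%:R|exists 1|exists 0]; rewrite !mxE.
Qed.

(** A unit vector parallel to S is S or -S, and three such signs with sum 1 are
    1, 1 and -1. *)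
Lemma parallel_rows (R : realType) (p : 'M[R]_3) :
  sphere3 p -> dot (vector_sum p) (vector_sum p) = 1 ->
  (forall i, cross (vector_sum p) (row i p) = 0) ->
  exists m, p = sign_col R m *m vector_sum p.
Proof.
move=> /sphere3P pS; set S := vector_sum p => SS par.
pose e i := dot S (row i p).
have pE i : row i p = e i *: S.
  have : cross (cross S (row i p)) S = row i p - e i *: S.
    rewrite -[row i p in RHS]scale1r -SS /e.
    by apply: row3P; rewrite !mxE !ord3E !dotE ?[row i p _ _]mxE; ring.
  rewrite par => /esym/eqP; rewrite (_ : cross 0 S = 0); last first.
    by apply: row3P; rewrite !mxE; ring.
  by rewrite subr_eq0 => /eqP.
have e2 i : e i ^+ 2 = 1.
  rewrite -(pS i) pE -[LHS]mulr1 -SS !dotE !mxE; ring.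
have sum1 : e 0 + e 1 + e 2%:R = 1.
  by rewrite -SS {2}/S vector_sumE /e !dotE !mxE; ring.
have [m [m0 m1 m2]] := sign_colE (e2 0) (e2 1) (e2 2%:R) sum1.
exists m; apply/row_matrixP => i; rewrite pE row_mul.
suff -> : row i (sign_col R m) = (e i)%:M by rewrite mul_scalar_mx.
apply/matrixP => x y; rewrite !ord1 2![LHS]mxE [RHS]mxE mulr1n.
by elim/ord3_ind: i; [rewrite m0|rewrite m1|rewrite m2]; rewrite mxE.
Qed.

(** With second_col, a basis of the columns with sum 0 that diagonalizes J_col
    of the signs. *)
Definition first_col (R : realType) (m : 'I_3) : 'cV[R]_3 :=
  delta_mx (m + 1) 0 - delta_mx m 0.

Definition second_col (R : realType) (m : 'I_3) : 'cV[R]_3 :=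
  delta_mx (m + 2%:R) 0 - delta_mx m 0.

Definition col_sum (R : realType) (t : 'cV[R]_3) : R := \sum_i t i 0.

Lemma col3P (R : realType) (s t : 'cV[R]_3) :
  s 0 0 = t 0 0 -> s 1 0 = t 1 0 -> s 2%:R 0 = t 2%:R 0 -> s = t.
Proof. by move=> *; apply/colP; elim/ord3_ind. Qed.

Lemma sign_col_sqr (R : realType) (m i : 'I_3) : sign_col R m i 0 * sign_col R m i 0 = 1.
Proof. by rewrite mxE; case: eqP => _; rewrite ?mulrNN mulr1. Qed.

Lemma col_sum_sign (R : realType) (m : 'I_3) : col_sum (sign_col R m) = 1.
Proof. by rewrite /col_sum sum_ord3; elim/ord3_ind: m; rewrite !mxE /=; ring. Qed.

Lemma col_sum_first (R : realType) (m : 'I_3) : col_sum (first_col R m) = 0.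
Proof. by rewrite /col_sum sum_ord3; elim/ord3_ind: m; rewrite !mxE /=; ring. Qed.

Lemma col_sum_second (R : realType) (m : 'I_3) : col_sum (second_col R m) = 0.
Proof. by rewrite /col_sum sum_ord3; elim/ord3_ind: m; rewrite !mxE /=; ring. Qed.

(** As first_col and second_col have sum 0, the coefficient on the column of
    signs is the sum of t; the others are then read off at m + 1 and m + 2. *)
Lemma col_decomposition (R : realType) (m : 'I_3) (t : 'cV[R]_3) :
  t = (t (m + 1) 0 - col_sum t) *: first_col R m
    + (t (m + 2%:R) 0 - col_sum t) *: second_col R m
    + col_sum t *: sign_col R m.
Proof.
rewrite /col_sum sum_ord3; elim/ord3_ind: m; rewrite !ord3E.
- by apply: col3P; rewrite !mxE /=; ring.
- by apply: col3P; rewrite !mxE /=; ring.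
- by apply: col3P; rewrite !mxE /=; ring.
Qed.

Lemma col_independent (R : realType) (m : 'I_3) (x y z : R) :
  x *: first_col R m + y *: second_col R m + z *: sign_col R m = 0 ->
  [/\ x = 0, y = 0 & z = 0].
Proof.
move=> /colP E; move: (E m) (E (m + 1)) (E (m + 2%:R)).
by elim/ord3_ind: m E => _; rewrite !ord3E !mxE /= => *; split; lra.
Qed.

(** The operator omega^{-1} d^2 J on the outer products of a column t and a
    vector orthogonal to W, where e is the column of signs
    (lemma [hessian_funJ_outer]). *)
Definition J_col (R : realType) (e t : 'cV[R]_3) : 'cV[R]_3 :=
  \col_i (e i 0 * (e (i + 1) 0 * t (i + 2%:R) 0 - e (i + 2%:R) 0 * t (i + 1) 0)).

Lemma J_col_first (R : realType) (m : 'I_3) :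
  J_col (sign_col R m) (first_col R m) = - first_col R m.
Proof.
elim/ord3_ind: m; rewrite /first_col !ord3E;
  apply: col3P; rewrite !mxE !ord3E /=; ring.
Qed.

Lemma J_col_second (R : realType) (m : 'I_3) :
  J_col (sign_col R m) (second_col R m) = second_col R m.
Proof.
elim/ord3_ind: m; rewrite /second_col !ord3E;
  apply: col3P; rewrite !mxE !ord3E /=; ring.
Qed.

Lemma J_col_sign (R : realType) (e : 'cV[R]_3) : J_col e e = 0.
Proof. by apply/colP => i; rewrite !mxE; ring. Qed.

(** The factor of omega that involves columns (lemma [omega_outer]). *)
Definition sign_form (R : realType) (m : 'I_3) (s t : 'cV[R]_3) : R :=
  \sum_i sign_col R m i 0 * (s i 0 * t i 0).

Lemma sign_form_ff (R : realType) (m : 'I_3) :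
  sign_form m (first_col R m) (first_col R m) = 0.
Proof. by rewrite /sign_form sum_ord3; elim/ord3_ind: m; rewrite !mxE /=; ring. Qed.

Lemma sign_form_ss (R : realType) (m : 'I_3) :
  sign_form m (second_col R m) (second_col R m) = 0.
Proof. by rewrite /sign_form sum_ord3; elim/ord3_ind: m; rewrite !mxE /=; ring. Qed.

Lemma sign_form_fs (R : realType) (m : 'I_3) :
  sign_form m (first_col R m) (second_col R m) = -1.
Proof. by rewrite /sign_form sum_ord3; elim/ord3_ind: m; rewrite !mxE /=; ring. Qed.

Lemma sign_formC (R : realType) (m : 'I_3) (s t : 'cV[R]_3) :
  sign_form m s t = sign_form m t s.
Proof. by apply: eq_bigr => i _; rewrite [s i 0 * _]mulrC. Qed.

Lemma row_outer (R : realType) (t : 'cV[R]_3) (x : 'rV[R]_3) (i : 'I_3) :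
  row i (t *m x) = t i 0 *: x.
Proof. by apply/rowP => j; rewrite !mxE big_ord1. Qed.

Lemma vector_sum_outer (R : realType) (t : 'cV[R]_3) (x : 'rV[R]_3) :
  vector_sum (t *m x) = col_sum t *: x.
Proof. by rewrite /col_sum sum_ord3 vector_sumE !row_outer !scalerDl. Qed.

Section SignPoint.
Variables (R : realType) (m : 'I_3) (W : 'rV[R]_3).
Hypothesis W_unit : dot W W = 1.
Let p := sign_col R m *m W.
Let eps i := sign_col R m i 0.

Lemma row_sign_point i : row i p = eps i *: W.
Proof. exact: row_outer. Qed.

Lemma sign_point_sphere : sphere3 p.
Proof.
apply/sphere3P => i; rewrite row_sign_point -W_unit -[RHS]mul1r.
by rewrite -(sign_col_sqr R m i) /eps !dotE !mxE; ring.
Qed.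

Lemma vector_sum_sign_point : vector_sum p = W.
Proof. by rewrite vector_sum_outer col_sum_sign scale1r. Qed.

Lemma funH_sign_point : funH p = 1.
Proof. by rewrite /funH /enorm vector_sum_sign_point W_unit sqrtr1. Qed.

Lemma tangent_sign_point v :
  reflect (forall i, dot W (row i v) = 0) (v \in tangent p).
Proof.
have E i : dot (row i v) (row i p) = eps i * dot W (row i v).
  by rewrite row_sign_point !dotE !mxE; ring.
apply: (iffP (tangentP p v)) => h i; last by rewrite E h mulr0.
by rewrite -[LHS]mul1r -(sign_col_sqr R m i) -mulrA -E h mulr0.
Qed.

Lemma omega_sign_point v w :
  omega p v w = \sum_i eps i * volume W (row i v) (row i w).
Proof.
apply: eq_bigr => i _; rewrite row_sign_point /omega_std /volume.
by rewrite !dotE !mxE; ring.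
Qed.

Lemma omega_outer s t x y :
  omega p (s *m x) (t *m y) = sign_form m s t * volume W x y.
Proof.
rewrite omega_sign_point mulr_suml; apply: eq_bigr => i _.
by rewrite !row_outer /eps /volume !dotE !crossE !mxE; ring.
Qed.

Lemma outer_tangent t x : dot W x = 0 -> t *m x \in tangent p.
Proof.
move=> Wx; apply/tangent_sign_point => i; rewrite row_outer.
by rewrite -[RHS](mulr0 (t i 0)) -Wx !dotE !mxE; ring.
Qed.

Lemma dot_vector_sum_tangent v : v \in tangent p -> dot W (vector_sum v) = 0.
Proof.
move=> /tangent_sign_point vp; rewrite vector_sumE.
transitivity (dot W (row 0 v) + dot W (row 1 v) + dot W (row 2%:R v)).
  by rewrite !dotE !mxE; ring.
by rewrite !vp !addr0.
Qed.

Lemma volume_rotate x y : volume W (cross W x) y =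
  dot W x * dot W y - dot W W * dot x y.
Proof. by rewrite /volume !dotE !crossE; ring. Qed.

(** I generates the simultaneous rotation of the three spheres about e3. *)
Lemma hamiltonian_vector_funI :
  hamiltonian_vector (@funI R) p = sign_col R m *m cross e3 W.
Proof.
apply: (omega_inv_eq sign_point_sphere).
  by apply: outer_tangent; rewrite !dotE !crossE; ring.
move=> v vp; rewrite differential_funI omega_sign_point.
have E i : eps i * volume W (row i (sign_col R m *m cross e3 W)) (row i v) =
    dot (row i v) e3.
  have /tangent_sign_point/(_ i) vi := vp.
  rewrite row_outer -/(eps i).
  transitivity (eps i * eps i * (dot W W * dot (row i v) e3 -
     dot W e3 * dot W (row i v))).
    by rewrite /volume !dotE !mxE !ord3E; ring.
  by rewrite sign_col_sqr W_unit vi; ring.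
by under eq_bigr do rewrite E; rewrite sum_ord3 vector_sumE !dotE !mxE; ring.
Qed.

(** H generates a rotation about the sum of the rows, and p is fixed by the
    rotations about W; this is the linearization.  The term in eps i comes from
    the motion of the axis. *)
Lemma hessian_operator_funH v : v \in tangent p ->
  hessian_operator (@funH R) p v =
  \matrix_i cross W (row i v - eps i *: vector_sum v).
Proof.
move=> vp; apply: (omega_inv_eq sign_point_sphere).
  by apply/tangent_sign_point => i; rewrite rowK !dotE !crossE; ring.
move=> w wp; rewrite hessian_funH ?funH_sign_point // vector_sum_sign_point.
rewrite (dot_vector_sum_tangent vp) mul0r subr0 omega_sign_point.
have E i : eps i * volume W (row i (\matrix_i cross W (row i v - eps i *: vector_sum v)))
    (row i w) = dot (vector_sum v) (row i w) - eps i * dot (row i v) (row i w).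
  rewrite rowK volume_rotate W_unit; have /tangent_sign_point/(_ i) -> := wp.
  rewrite mulr0 sub0r mul1r.
  transitivity (eps i * eps i * dot (vector_sum v) (row i w)
     - eps i * dot (row i v) (row i w)); first by rewrite !dotE !mxE; ring.
  by rewrite sign_col_sqr mul1r.
under eq_bigr do rewrite E.
have acc : dot W (vector_sum (sphere_acceleration p v w)) =
    - \sum_i eps i * dot (row i v) (row i w).
  rewrite -[RHS]mulr1 -W_unit vector_sumE !rowK !row_sign_point sum_ord3.
  rewrite [dot W _]dotE !mxE [dot W W]dotE.
  move: (eps 0) (eps 1) (eps 2%:R) => s0 s1 s2.
  by move: (dot (row 0 v) _) (dot (row 1 v) _) (dot (row 2%:R v) _) => *; ring.
by rewrite acc !sum_ord3 !vector_sumE !dotE !mxE; ring.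
Qed.

(** The curvature terms vanish because the rows of p are parallel, and only the
    product terms of the determinant remain. *)
Lemma hessian_operator_funJ v : v \in tangent p ->
  hessian_operator (@funJ R) p v =
  \matrix_i (eps i *: (eps (i + 1) *: row (i + 2%:R) v
                       - eps (i + 2%:R) *: row (i + 1) v)).
Proof.
move=> /tangent_sign_point vp; apply: (omega_inv_eq sign_point_sphere).
  apply/tangent_sign_point => i; rewrite rowK.
  transitivity (eps i * (eps (i + 1) * dot W (row (i + 2%:R) v)
      - eps (i + 2%:R) * dot W (row (i + 1) v))).
    by rewrite !dotE !mxE; ring.
  by rewrite !vp !mulr0 subrr mulr0.
move=> w wp; rewrite hessian_funJ omega_sign_point.
have E i : eps i * volume W (row i (\matrix_i (eps i *:
     (eps (i + 1) *: row (i + 2%:R) v - eps (i + 2%:R) *: row (i + 1) v))))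
    (row i w) = eps (i + 1) * volume W (row (i + 2%:R) v) (row i w)
     - eps (i + 2%:R) * volume W (row (i + 1) v) (row i w).
  rewrite rowK.
  transitivity (eps i * eps i * (eps (i + 1) * volume W (row (i + 2%:R) v) (row i w)
     - eps (i + 2%:R) * volume W (row (i + 1) v) (row i w))).
    by rewrite /volume !dotE !crossE !mxE; ring.
  by rewrite sign_col_sqr mul1r.
under eq_bigr do rewrite E.
rewrite sum_ord3 !ord3E /cyclic_volume !rowK !row_sign_point /volume.
by rewrite !dotE !crossE !mxE; ring.
Qed.

End SignPoint.

(** * The focus-focus Cartan subalgebra of sp(4, R) *)

(** A list of rows, so that an entry only depends on the values of its indices
    and reduces by computation. *)
Definition mx4 (R : realType) (s : seq (seq R)) : 'M[R]_4 :=
  \matrix_(i, j) (nth [::] s i)`_j.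

(** The operator of H in reduced_basis: multiplication by i in both complex
    coordinates. *)
Definition rotation4 (R : realType) : 'M[R]_4 :=
  mx4 [:: [:: 0; -1; 0; 0]; [:: 1; 0; 0; 0]; [:: 0; 0; 0; -1]; [:: 0; 0; 1; 0]].

(** The operator of J in reduced_basis. *)
Definition signature4 (R : realType) : 'M[R]_4 :=
  mx4 [:: [:: -1; 0; 0; 0]; [:: 0; -1; 0; 0]; [:: 0; 0; 1; 0]; [:: 0; 0; 0; 1]].

(** The Gram matrix of omega in reduced_basis (lemma [gram_reduced_basis]). *)
Definition gram4 (R : realType) (k : R) : 'M[R]_4 :=
  mx4 [:: [:: 0; 0; 0; - k]; [:: 0; 0; k; 0]; [:: 0; - k; 0; 0]; [:: k; 0; 0; 0]].

Definition focus_algebra (R : realType) : {vspace 'M[R]_4} :=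
  <<[tuple rotation4 R; signature4 R]>>%VS.

Definition focus_element (R : realType) (a b : R) : 'M[R]_4 :=
  a *: rotation4 R + b *: signature4 R.

Lemma focus_elementE (R : realType) (a b : R) :
  focus_element a b = mx4 [:: [:: - b; - a; 0; 0]; [:: a; - b; 0; 0];
                              [:: 0; 0; b; - a]; [:: 0; 0; a; b]].
Proof.
apply/matrixP => -[[|[|[|[|//]]]] ?] -[[|[|[|[|//]]]] ?]; rewrite !mxE /=; ring.
Qed.

Lemma focus_algebraP (R : realType) (x : 'M[R]_4) :
  reflect (exists a b, x = focus_element a b) (x \in focus_algebra R).
Proof.
rewrite /focus_algebra /= span_cons span_seq1.
apply: (iffP memv_addP) => [[u /vlineP[a ->] [v /vlineP[b ->] ->]]|[a [b ->]]].
  by exists a, b.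
by exists (a *: rotation4 R); [|exists (b *: signature4 R)];
  rewrite // memvZ // memv_line.
Qed.

(** The matrix of multiplication by the complex number x + iy. *)
Definition conformal_mx (R : realType) (x y : R) : 'M[R]_2 :=
  \matrix_(i, j) (if i == j then x else if i == 0 then - y else y).

Lemma ord2_ind (P : 'I_2 -> Prop) : P 0 -> P 1 -> forall i, P i.
Proof.
move=> h0 h1 [[|[|//]] i2].
- by rewrite (_ : Ordinal i2 = 0) //; exact: val_inj.
- by rewrite (_ : Ordinal i2 = 1) //; exact: val_inj.
Qed.

Lemma mx2P (R : realType) (x y : 'M[R]_2) :
  x 0 0 = y 0 0 -> x 0 1 = y 0 1 -> x 1 0 = y 1 0 -> x 1 1 = y 1 1 -> x = y.
Proof.
move=> h00 h01 h10 h11; apply/matrixP.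
by elim/ord2_ind; elim/ord2_ind.
Qed.

Lemma sum_ord2 (V : nmodType) (f : 'I_2 -> V) : \sum_i f i = f 0 + f 1.
Proof.
by rewrite !big_ord_recr big_ord0 /= add0r; congr (_ + _); congr f; exact: val_inj.
Qed.

Lemma conformal_mxM (R : realType) (x y u v : R) :
  conformal_mx x y *m conformal_mx u v =
  conformal_mx (x * u - y * v) (x * v + y * u).
Proof. by apply: mx2P; rewrite !mxE sum_ord2 !mxE /=; ring. Qed.

Lemma conformal_mxD (R : realType) (x y u v : R) :
  conformal_mx x y + conformal_mx u v = conformal_mx (x + u) (y + v).
Proof. by apply: mx2P; rewrite !mxE /=; ring. Qed.

Lemma conformal_mxN (R : realType) (x y : R) :
  - conformal_mx x y = conformal_mx (- x) (- y).
Proof. by apply: mx2P; rewrite !mxE /=; ring. Qed.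

Lemma conformal_mxT (R : realType) (x y : R) :
  (conformal_mx x y)^T = conformal_mx x (- y).
Proof. by apply: mx2P; rewrite !mxE /=; ring. Qed.

Lemma conformal_mx0 (R : realType) : conformal_mx 0 0 = 0 :> 'M[R]_2.
Proof. by apply: mx2P; rewrite !mxE /=; ring. Qed.

Lemma conformal_mx_eq0 (R : realType) (x y : R) :
  conformal_mx x y = 0 -> x = 0 /\ y = 0.
Proof. by move=> /matrixP E; move: (E 0 0) (E 1 0); rewrite !mxE. Qed.

Lemma conformal_mx1 (R : realType) : conformal_mx 1 0 = 1%:M :> 'M[R]_2.
Proof. by apply: mx2P; rewrite !mxE /= ?oppr0. Qed.

(** A commutator with multiplication by i anticommutes with it; if it is also
    complex linear, then it is zero, and P itself is complex linear. *)
Lemma commutator_conformal (R : realType) (P : 'M[R]_2) (x y : R) :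
  P *m conformal_mx 0 1 - conformal_mx 0 1 *m P = conformal_mx x y ->
  exists u v, P = conformal_mx u v.
Proof.
move=> /matrixP E; exists (P 0 0), (P 1 0).
move: (E 0 0) (E 0 1) (E 1 0) (E 1 1); rewrite !mxE !sum_ord2 !mxE /= => *.
by apply: mx2P; rewrite !mxE /=; lra.
Qed.

Lemma focus_element_block (R : realType) (a b : R) :
  focus_element a b =
  block_mx (conformal_mx (- b) a) 0 0 (conformal_mx b a) :> 'M[R]_(2 + 2).
Proof.
rewrite -[LHS](@submxK _ 2 2 2 2) focus_elementE; congr block_mx;
  by apply: mx2P; rewrite !mxE.
Qed.

Lemma gram4_block (R : realType) (k : R) :
  gram4 k = block_mx 0 (conformal_mx 0 k) (conformal_mx 0 k) 0 :> 'M[R]_(2 + 2).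
Proof.
rewrite -[LHS](@submxK _ 2 2 2 2); congr block_mx;
  by apply: mx2P; rewrite !mxE.
Qed.

Lemma block_mx_ext (R : realType) (P P' Q Q' S S' T T' : 'M[R]_2) :
  P = P' -> Q = Q' -> S = S' -> T = T' ->
  block_mx P Q S T = block_mx P' Q' S' T'.
Proof. by move=> -> -> -> ->. Qed.

Lemma commuting_focus (R : realType) (x y : 'M[R]_4) :
  x \in focus_algebra R -> y \in focus_algebra R -> lie x y = 0.
Proof.
move=> /focus_algebraP[a [b ->]] /focus_algebraP[c [d ->]].
rewrite /lie !focus_element_block !(@mulmx_block _ 2 2 2 2 2 2).
rewrite !mul0mx !mulmx0 !addr0 !add0r !conformal_mxM -[RHS](@block_mx0 _ 2 2 2 2).
rewrite (@opp_block_mx _ 2 2 2 2) (@add_block_mx _ 2 2 2 2) subr0.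
rewrite !conformal_mxN !conformal_mxD.
apply: block_mx_ext => //.
  by rewrite -conformal_mx0; congr conformal_mx; ring.
by rewrite -conformal_mx0; congr conformal_mx; ring.
Qed.

Lemma cartan_focus_algebra (R : realType) (k : R) : k != 0 ->
  cartan_subalgebra (gram4 k) (focus_algebra R).
Proof.
move=> k0; split.
- move=> _ /focus_algebraP[a [b ->]]; rewrite /symplectic_algebra /=.
  rewrite focus_element_block gram4_block (@tr_block_mx _ 2 2 2 2).
  rewrite !(@mulmx_block _ 2 2 2 2 2 2) (@add_block_mx _ 2 2 2 2).
  rewrite !trmx0 !mul0mx !mulmx0 !addr0 !add0r !conformal_mxT !conformal_mxM.
  rewrite !conformal_mxD -[RHS](@block_mx0 _ 2 2 2 2) -conformal_mx0.
  by apply: block_mx_ext => //; congr conformal_mx; ring.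
- by move=> a b ha hb; rewrite commuting_focus // mem0v.
- rewrite /lie_nilpotent; exists 1%N; apply/eqP; rewrite -subv0.
  apply/span_subvP => x.
  move=> /allpairsP[[a b] [/= /vbasis_mem ha /vbasis_mem hb ->]].
  by rewrite commuting_focus // mem0v.
- move=> x; rewrite /symplectic_algebra /= => xs xn.
  (* The bracket with the signature doubles the off-diagonal blocks of x up to
     sign, so they vanish; the bracket with the rotation makes the diagonal
     blocks complex linear, and the symplectic condition relates them. *)
  have /focus_algebraP[a [b]] : lie x (focus_element 1 0) \in focus_algebra R.
    by apply: xn; apply/focus_algebraP; exists 1, 0.
  have /focus_algebraP[c [d]] : lie x (focus_element 0 1) \in focus_algebra R.
    by apply: xn; apply/focus_algebraP; exists 0, 1.
  move: (etrans xs (esym (@block_mx0 R 2 2 2 2))); rewrite /lie -[x](@submxK _ 2 2 2 2).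
  move: (@ulsubmx _ 2 2 2 2 x) (@ursubmx _ 2 2 2 2 x)
    (@dlsubmx _ 2 2 2 2 x) (@drsubmx _ 2 2 2 2 x) => P Q S T.
  rewrite !focus_element_block gram4_block !(@tr_block_mx _ 2 2 2 2).
  rewrite !(@mulmx_block _ 2 2 2 2 2 2) !(@opp_block_mx _ 2 2 2 2).
  rewrite !(@add_block_mx _ 2 2 2 2).
  rewrite !mul0mx !mulmx0 !addr0 !add0r.
  move=> /(@eq_block_mx _ 2 2 2 2)[_ PT _ _].
  move=> /(@eq_block_mx _ 2 2 2 2)[_ Q0 S0 _].
  move=> /(@eq_block_mx _ 2 2 2 2)[PR _ _ TR].
  rewrite oppr0 in PR.
  have {PR} [p [q Pp]] := commutator_conformal PR.
  have {TR} [t [u Tt]] := commutator_conformal TR.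
  have neg1 : conformal_mx (-1) 0 = - 1%:M :> 'M[R]_2.
    by rewrite -conformal_mx1 conformal_mxN oppr0.
  have {}Q0 : Q = 0.
    move: Q0; rewrite neg1 conformal_mx1 mulmx1 mulNmx mul1mx opprK -mulr2n.
    by move/eqP; rewrite -scaler_nat scaler_eq0 pnatr_eq0 => /eqP.
  have {}S0 : S = 0.
    move: S0; rewrite neg1 conformal_mx1 mulmxN mulmx1 mul1mx -opprD -mulr2n.
    by move/eqP; rewrite oppr_eq0 -scaler_nat scaler_eq0 pnatr_eq0 => /eqP.
  move: PT; rewrite Pp Tt conformal_mxT !conformal_mxM conformal_mxD.
  move=> /conformal_mx_eq0[qu pt].
  have uq : u = q by apply: (mulfI k0); lra.
  have tp : t = - p by apply: (mulfI k0); lra.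
  apply/focus_algebraP; exists q, (- p); rewrite focus_element_block opprK.
  by rewrite Q0 S0 uq tp.
Qed.

Lemma det_mx2 (K : comNzRingType) (A : 'M[K]_2) :
  \det A = A 0 0 * A 1 1 - A 0 1 * A 1 0.
Proof.
rewrite (expand_det_row _ 0) sum_ord2 /cofactor !det_mx11 !mxE /=.
have -> : lift 0 0 = 1 :> 'I_2 by exact: val_inj.
have -> : lift 1 0 = 0 :> 'I_2 by exact: val_inj.
by rewrite expr0 expr1 mul1r mulN1r mulrN.
Qed.

Lemma conformal_mx_spectrum (R : realType) (x y : R) :
  char_poly (map_mx (real_complex R) (conformal_mx x y)) =
  ('X - (Complex x y)%:P) * ('X - (Complex x (- y))%:P).
Proof.
have trE : Complex x y + Complex x (- y) = real_complex R x *+ 2.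
  by rewrite mulr2n; apply/eqP; rewrite eq_complex /= subrr addr0 !eqxx.
have normE : Complex x y * Complex x (- y) =
    real_complex R x ^+ 2 + real_complex R y ^+ 2.
  apply/eqP; rewrite eq_complex /=; apply/andP; split; apply/eqP; ring.
have -> : ('X - (Complex x y)%:P) * ('X - (Complex x (- y))%:P) =
    'X ^+ 2 - (Complex x y + Complex x (- y))%:P * 'X +
    (Complex x y * Complex x (- y))%:P.
  by rewrite polyCD polyCM; ring.
rewrite trE normE /char_poly det_mx2 !mxE /= rmorphN /= !polyCD !polyCM !polyCN.
ring.
Qed.

Lemma focus_element_spectrum (R : realType) (a b : R) :
  spectrum (focus_element a b) (focus_focus_eigenvalues b a).
Proof.
rewrite /spectrum focus_element_block (@map_block_mx _ _ _ 2 2 2 2) !map_mx0.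
rewrite /char_poly (@char_block_diag_mx _ 2 2) (@det_ublock _ 2 2).
rewrite -!/(char_poly _) !conformal_mx_spectrum /focus_focus_eigenvalues.
by rewrite !big_cons big_nil; ring.
Qed.

(** The eigenvalues of a generic element are distinct, which excludes a = 0 and
    b = 0. *)
Lemma focus_algebra_williamson (R : realType) :
  algebra_williamson_type (focus_algebra R) 0 0 1.
Proof.
split=> //.
  exists (focus_element 1 1), (focus_focus_eigenvalues 1 1); split.
  - by apply/focus_algebraP; exists 1, 1.
  - exact: focus_element_spectrum.
  - have n1 : (1 == -1 :> R) = false by apply/eqP => h; lra.
    have n2 : (-1 == 1 :> R) = false by apply/eqP => h; lra.
    by rewrite /= !inE !eq_complex /= !eqxx !n1 !n2.
move=> _ z /focus_algebraP[a [b ->]] hz uz.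
have zE : perm_eq z (focus_focus_eigenvalues b a).
  by apply: prod_XsubC_eq; rewrite -hz focus_element_spectrum.
move: uz; rewrite (perm_uniq zE) /= !inE !eq_complex /= !negb_or => u.
exists (fun=> 0), (fun=> 0), (fun=> b), (fun=> a); split; try by case.
  move=> _; split; apply/eqP => e0; move: u; rewrite e0 !oppr0 !eqxx /= ?andbF //.
by rewrite !(size0nil (size_enum_ord 0)) /= enum_ordSl /= (size0nil (size_enum_ord 0)).
Qed.

(** * Reduction by the rotation generated by I *)

Lemma dot_combination (R : realType) (x y z : 'rV[R]_3) (s t : R) :
  dot x (s *: y + t *: z) = s * dot x y + t * dot x z.
Proof. by rewrite !dotE !mxE; ring. Qed.

Lemma dotC (R : realType) (x y : 'rV[R]_3) : dot x y = dot y x.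
Proof. by rewrite !dotE; ring. Qed.

Lemma cross_cross (R : realType) (x y z : 'rV[R]_3) :
  cross x (cross y z) = dot x z *: y - dot x y *: z.
Proof. by rewrite !dotE; apply: row3P; rewrite !(mxE, ord3E); ring. Qed.

Lemma outer_combination (R : realType) (s t : 'cV[R]_3) (x y : 'rV[R]_3)
    (x1 x2 x3 x4 : R) :
  x1 *: (s *m x) + (x2 *: (s *m y) + (x3 *: (t *m x) + x4 *: (t *m y))) =
  (x1 *: s + x3 *: t) *m x + (x2 *: s + x4 *: t) *m y.
Proof. by rewrite !mulmxDl -!scalemxAl [RHS]addrACA !addrA. Qed.

Section Reduction.
Variables (R : realType) (m : 'I_3) (W : 'rV[R]_3).
Hypothesis W_unit : dot W W = 1.
Let p := sign_col R m *m W.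
Let a := cross e3 W.
Let b := cross W a.
Let k := 1 - dot W e3 ^+ 2.
Hypothesis k_neq0 : k != 0.

Let dotWa : dot W a = 0.
Proof. by rewrite !dotE !crossE; ring. Qed.

Let dotWb : dot W b = 0.
Proof. by rewrite !dotE !crossE; ring. Qed.

Let dotaa : dot a a = k.
Proof. by rewrite dot_cross_e3 W_unit. Qed.

Let dotab : dot a b = 0.
Proof. by rewrite /b !dotE !crossE; ring. Qed.

Let dotbb : dot b b = k.
Proof.
transitivity (dot W W * dot a a - dot W a ^+ 2).
  by rewrite /b !dotE !crossE; ring.
by rewrite W_unit dotWa dotaa mul1r expr0n subr0.
Qed.

Let crossWb : cross W b = - a.
Proof.
by rewrite /b cross_cross dotWa W_unit scale0r scale1r sub0r.
Qed.

Let volab : volume W a b = k.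
Proof. by rewrite -dotbb /volume !dotE /b !crossE; ring. Qed.

Let volba : volume W b a = - k.
Proof. by rewrite -volab /volume !dotE !crossE; ring. Qed.

Lemma volume_alternating (x : 'rV[R]_3) : volume W x x = 0.
Proof. by rewrite /volume !dotE !crossE; ring. Qed.

(** The frame (a, b, W) is orthogonal, and a and b have square norm k. *)
Lemma tangent_decomposition v : v \in tangent p ->
  exists s t : 'cV[R]_3, v = s *m a + t *m b.
Proof.
move=> /tangent_sign_point vp.
exists (\col_i (dot (row i v) a / k)), (\col_i (dot (row i v) b / k)).
apply/row_matrixP => i; rewrite linearD /= !row_outer !mxE.
apply: (scalerI k_neq0); rewrite scalerDr !scalerA ![k * _]mulrC !divfK //.
transitivity (dot W W *: (dot (row i v) a *: a) + dot (row i v) b *: b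
              + (dot a a * dot W (row i v)) *: W); last first.
  by rewrite W_unit vp mulr0 scale0r addr0 scale1r.
have -> : k = dot a a * dot W W by rewrite dotaa W_unit mulr1.
move: (row i v) => x; rewrite /b /a; move: (e3 : 'rV[R]_3) => e.
by apply: row3P; rewrite !(dotE, mxE, ord3E); ring.
Qed.

Lemma outer_independent (s t : 'cV[R]_3) :
  s *m a + t *m b = 0 -> s = 0 /\ t = 0.
Proof.
move=> st; have E i : s i 0 *: a + t i 0 *: b = 0.
  by rewrite -!row_outer -linearD st linear0.
split; apply/colP => i; rewrite [RHS]mxE; apply: (mulIf k_neq0); rewrite mul0r.
  transitivity (dot a (s i 0 *: a + t i 0 *: b)).
    by rewrite dot_combination dotaa dotab mulr0 addr0.
  by rewrite E !dotE !mxE !mulr0 !addr0.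
transitivity (dot b (s i 0 *: a + t i 0 *: b)).
  by rewrite dot_combination dotbb dotC dotab mulr0 add0r.
by rewrite E !dotE !mxE !mulr0 !addr0.
Qed.

Let f := first_col R m.
Let g := second_col R m.
Let sg := sign_col R m.

Lemma omegaDl v v' w : omega p (v + v') w = omega p v w + omega p v' w.
Proof.
rewrite !omega_sign_point -big_split; apply: eq_bigr => i _ /=.
by rewrite /volume !dotE !crossE !mxE; ring.
Qed.

(** The vectors a and b = W x a are an orthogonal real basis of the plane
    orthogonal to W; the columns f and g have sum 0, and so do the triples. *)
Definition reduced_basis : 4.-tuple 'M[R]_3 :=
  [tuple f *m a; f *m b; g *m a; g *m b].
Let e := reduced_basis.

Lemma span_reduced_basis v :
  v \in <<e>>%VS <-> exists x1 x2 x3 x4 : R,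
    v = (x1 *: f + x3 *: g) *m a + (x2 *: f + x4 *: g) *m b.
Proof.
rewrite /e /= !span_cons span_nil addv0; split.
  move=> /memv_addP[_ /vlineP[x1 ->] [_ /memv_addP[_ /vlineP[x2 ->]
    [_ /memv_addP[_ /vlineP[x3 ->] [_ /vlineP[x4 ->] ->]] ->]] ->]].
  by exists x1, x2, x3, x4; rewrite outer_combination.
move=> [x1 [x2 [x3 [x4 ->]]]]; rewrite -outer_combination.
by rewrite !memv_add // memvZ // memv_line.
Qed.

Lemma free_reduced_basis : free e.
Proof.
apply/freeP => x; rewrite !big_ord_recl big_ord0 /= addr0.
set x0 := x _; set x1 := x _; set x2 := x _; set x3 := x _ => x_0.
have : (x0 *: f + x2 *: g) *m a + (x1 *: f + x3 *: g) *m b = 0.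
  by rewrite -outer_combination.
move=> /outer_independent[fg0 fg1].
have [] := @col_independent R m x0 x2 0; first by rewrite scale0r addr0.
have [] := @col_independent R m x1 x3 0; first by rewrite scale0r addr0.
move=> y1 y3 _ y0 y2 _.
move=> -[[|[|[|[|//]]]] i4].
- by rewrite -[RHS]y0; congr x; exact: val_inj.
- by rewrite -[RHS]y1; congr x; exact: val_inj.
- by rewrite -[RHS]y2; congr x; exact: val_inj.
- by rewrite -[RHS]y3; congr x; exact: val_inj.
Qed.

Let L := <[sg *m a]>%VS.

Lemma orbit_complement : (L :&: <<e>> = 0)%VS.
Proof.
apply/eqP; rewrite -subv0; apply/subvP => v.
rewrite memv_cap => /andP[/vlineP[y vE] /span_reduced_basis[x1 [x2 [x3 [x4 vE']]]]].
have : (x1 *: f + x3 *: g + (- y) *: sg) *m a + (x2 *: f + x4 *: g) *m b = 0.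
  rewrite mulmxDl -addrA [_ + _ *m b]addrC addrA -vE' vE.
  by rewrite -scalemxAl scaleNr subrr.
move=> /outer_independent[/col_independent[_ _ /eqP]].
by rewrite oppr_eq0 => /eqP y0 _; rewrite vE y0 scale0r mem0v.
Qed.

(** Only the component along b of the sum of a triple pairs with the orbit
    direction. *)
Lemma omega_orbit s t :
  omega p (s *m a + t *m b) (sg *m a) = - (k * col_sum t).
Proof.
rewrite omegaDl !omega_outer // volume_alternating volba mulr0 add0r.
rewrite mulrN mulrC; congr (- (_ * _)); apply: eq_bigr => i _.
by rewrite mulrCA sign_col_sqr mulr1.
Qed.

Lemma orbit_orthogonal v :
  symplectic_orthogonal p L v <-> v \in (L + <<e>>)%VS.
Proof.
split=> [[vp vL]|/memv_addP[_ /vlineP[y ->] [w]]].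
  have [s [t vE]] := tangent_decomposition vp.
  have t0 : col_sum t = 0.
    have /eqP := vL _ (memv_line (sg *m a)).
    by rewrite vE omega_orbit oppr_eq0 mulf_eq0 (negPf k_neq0) => /eqP.
  rewrite vE (col_decomposition m s) (col_decomposition m t) t0 scale0r addr0.
  rewrite mulmxDl addrAC addrC -scalemxAl.
  apply: memv_add; first by rewrite memvZ ?memv_line.
  by apply/span_reduced_basis; do 4 eexists.
move=> /span_reduced_basis[x1 [x2 [x3 [x4 ->]]]] ->; split.
  by rewrite !rpredD // ?rpredZ // outer_tangent.
move=> _ /vlineP[c ->].
rewrite addrA scalemxAl -mulmxDl.
have -> s t : omega p (s *m a + t *m b) (c *: (sg *m a)) =
    c * omega p (s *m a + t *m b) (sg *m a).
  rewrite !omega_sign_point mulr_sumr; apply: eq_bigr => i _.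
  by rewrite /volume !dotE !crossE !mxE; ring.
rewrite omega_orbit (_ : col_sum _ = 0) ?mulr0 ?oppr0 ?mulr0 //.
transitivity (x2 * col_sum f + x4 * col_sum g).
  by rewrite /col_sum !mulr_sumr -big_split; apply: eq_bigr => i _; rewrite !mxE.
by rewrite col_sum_first col_sum_second !mulr0 addr0.
Qed.

Lemma gram_reduced_basis : gram p e = gram4 k.
Proof.
have gf : sign_form m g f = -1 by rewrite sign_formC sign_form_fs.
apply/matrixP => -[[|[|[|[|//]]]] ?] -[[|[|[|[|//]]]] ?];
  rewrite mxE [RHS]mxE !(tnth_nth 0) /= omega_outer //
    ?gf ?sign_form_ff ?sign_form_ss ?sign_form_fs ?volume_alternating
    ?volab ?volba; ring.
Qed.

Lemma hessian_funH_outer (t : 'cV[R]_3) (x : 'rV[R]_3) : dot W x = 0 ->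
  hessian_operator (@funH R) p (t *m x) =
  (t - col_sum t *: sg) *m cross W x.
Proof.
move=> Wx; rewrite hessian_operator_funH ?outer_tangent //.
apply/row_matrixP => i; rewrite rowK !row_outer vector_sum_outer !mxE -/(sg i 0).
by apply: row3P; rewrite !mxE; ring.
Qed.

Lemma hessian_funJ_outer (t : 'cV[R]_3) (x : 'rV[R]_3) : dot W x = 0 ->
  hessian_operator (@funJ R) p (t *m x) = J_col sg t *m x.
Proof.
move=> Wx; rewrite hessian_operator_funJ ?outer_tangent //.
apply/row_matrixP => i; rewrite rowK !row_outer [J_col _ _ _ _]mxE.
by apply/rowP => j; rewrite 5!mxE !mxE; ring.
Qed.

Lemma induced_funH :
  induced_matrix L e (hessian_operator (@funH R) p) (rotation4 R).
Proof.
split=> [v /vlineP[y ->]|].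
  rewrite scalemxAl hessian_funH_outer // (_ : _ - _ = 0) ?mul0mx ?mem0v //.
  rewrite (_ : col_sum _ = y) ?subrr //.
  transitivity (y * col_sum sg); last by rewrite col_sum_sign mulr1.
  by rewrite /col_sum mulr_sumr; apply: eq_bigr => i _; rewrite !mxE.
move=> -[[|[|[|[|//]]]] ?]; rewrite !big_ord_recl big_ord0 !(tnth_nth 0) !mxE /=;
  rewrite hessian_funH_outer // ?col_sum_first ?col_sum_second scale0r subr0;
  rewrite ?crossWb ?mulmxN !scale0r ?scale1r ?scaleN1r ?oppr0 ?scale0r;
  by rewrite !(add0r, addr0) ?opprK ?addNr ?subrr mem0v.
Qed.

Lemma induced_funJ :
  induced_matrix L e (hessian_operator (@funJ R) p) (signature4 R).
Proof.
split=> [v /vlineP[y ->]|].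
  rewrite scalemxAr hessian_funJ_outer ?J_col_sign ?mul0mx ?mem0v //.
  by rewrite -[RHS](mulr0 y) -dotWa !dotE !mxE; ring.
move=> -[[|[|[|[|//]]]] ?]; rewrite !big_ord_recl big_ord0 !(tnth_nth 0) !mxE /=;
  rewrite hessian_funJ_outer // ?J_col_first ?J_col_second;
  rewrite ?mulNmx !scale0r ?scale1r ?scaleN1r;
  by rewrite !(add0r, addr0) ?opprK ?addNr ?subrr mem0v.
Qed.

End Reduction.

(** * Non-degeneracy and Williamson type *)

Lemma component_perm (R : realType) (F : 'M[R]_3 -> 'cV[R]_3) (s : {perm 'I_3})
    (i : 'I_3) :
  component (fun q => perm_mx s *m F q) i = component F (s i).
Proof. by apply/funext => q; rewrite /component -row_permE mxE. Qed.

Lemma differential_form_eq0 (R : realType) (f : 'M[R]_3 -> R) (p : 'M[R]_3) :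
  (forall v, v \in tangent p -> differential f p v = 0) ->
  differential_form f p = 0.
Proof.
move=> f0; rewrite /differential_form (_ : (fun _ => _) = \0) //.
by apply/funext => u; rewrite f0 // subvsP.
Qed.

Section Focus.
Variables (R : realType) (m : 'I_3) (W : 'rV[R]_3).
Hypothesis W_unit : dot W W = 1.
Let p := sign_col R m *m W.
Let k := 1 - dot W e3 ^+ 2.
Hypothesis k_neq0 : k != 0.

Lemma differential_form_funH0 : differential_form (@funH R) p = 0.
Proof.
apply: differential_form_eq0 => v vp.
rewrite differential_funH ?funH_sign_point // vector_sum_sign_point.
exact: dot_vector_sum_tangent vp.
Qed.

Lemma differential_form_funJ0 : differential_form (@funJ R) p = 0.
Proof.
apply: differential_form_eq0 => v _; rewrite differential_funJ.
rewrite /cyclic_volume !row_sign_point /volume.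
by rewrite !dotE !crossE !mxE; ring.
Qed.

(** Tested on the direction in which the rows move towards or away from e3. *)
Lemma differential_form_funI_neq0 : differential_form (@funI R) p != 0.
Proof.
have vp : sign_col R m *m cross W (cross e3 W) \in tangent p.
  by apply: outer_tangent; rewrite // !dotE !crossE; ring.
apply/eqP => I0; move: k_neq0; rewrite /k -W_unit -dot_cross_e3.
have := congr1 (fun f => fun_of_lfun f (vsproj (tangent p) _)) I0.
move=> /(_ (sign_col R m *m cross W (cross e3 W))).
rewrite differential_formE //; last first.
  by move=> c x y; rewrite !differential_funI vector_sum_linear dot_linear_l.
rewrite zero_lfunE differential_funI vector_sum_outer col_sum_sign scale1r.
rewrite (_ : dot _ e3 = dot (cross e3 W) (cross e3 W)) => [->|]; rewrite ?eqxx //.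
by rewrite !dotE !crossE; ring.
Qed.

Lemma rank_momentum : rank (@momentum R) p = 1%N.
Proof.
rewrite /rank differentials_momentum differential_form_funH0.
rewrite differential_form_funJ0 !span_cons span_nil addv0.
have -> : <[0 : 'Hom(subvs_of (tangent p), R^o)]>%VS = 0%VS.
  by apply/eqP; rewrite -dimv_eq0 dim_vline eqxx.
by rewrite add0v addv0 dim_vline differential_form_funI_neq0.
Qed.

Let s : {perm 'I_3} := tperm 1 2%:R.

(** The permutation s exchanges I and J, as the functions with zero differential
    have to come first. *)
Lemma reduced_focus_algebra :
  reduced_algebra (k := 2) (@momentum R) p (gram4 k) (focus_algebra R).
Proof.
have G0 : component (fun q => perm_mx s *m momentum q) 0 = @funH R.
  by rewrite component_perm tpermD // component_momentum0.
have G1 : component (fun q => perm_mx s *m momentum q) 1 = @funJ R.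
  by rewrite component_perm tpermL component_momentum2.
have G2 : component (fun q => perm_mx s *m momentum q) 2%:R = @funI R.
  by rewrite component_perm tpermR component_momentum1.
exists (perm_mx s), (reduced_basis m W), [tuple rotation4 R; signature4 R].
move=> G L.
have LE : L = <[sign_col R m *m cross e3 W]>%VS.
  rewrite /L (_ : [seq _ | i <- enum 'I_3 & _] =
                  [:: hamiltonian_vector (component G 2%:R) p]).
    by rewrite span_seq1 G2 hamiltonian_vector_funI.
  by rewrite enum_ord3.
split.
- by rewrite rank_momentum.
- exact: unitmx_perm.
- elim/ord3_ind => // _; first by rewrite G0 differential_form_funH0.
  by rewrite G1 differential_form_funJ0.
- rewrite LE; split; first exact: free_reduced_basis.
    exact: orbit_complement.
  exact: orbit_orthogonal.
- rewrite LE; split => //; last by rewrite gram_reduced_basis.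
  elim/ord3_ind => // _; first by rewrite G0; exact: induced_funH.
  by rewrite G1; exact: induced_funJ.
Qed.

End Focus.

Unset Implicit Arguments.

Theorem propositionA1 (R : realType) (p : 'M[R]_3) (s : R) :
  sphere3 p -> critical_point momentum p ->
  -1 < s < 1 -> momentum p = col3 1 s 0 ->
  nondegenerate_point momentum p /\ williamson_type momentum p 0 0 1.
Proof.
move=> pS crit s1 pE.
have H1 : funH p = 1 by have /colP/(_ 0) := pE; rewrite !mxE.
have Is : funI p = s by have /colP/(_ 1) := pE; rewrite !mxE.
have J0 : funJ p = 0 by have /colP/(_ 2%:R) := pE; rewrite !mxE.
rewrite -Is in s1.
have S1 := funH_eq1 H1.
have [m pm] := parallel_rows pS S1 (critical_point_parallel pS crit H1 s1 J0).
have k0 : 1 - dot (vector_sum p) e3 ^+ 2 != 0.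
  by rewrite gt_eqF // one_sub_sqr_gt0.
have red := reduced_focus_algebra m S1 k0.
rewrite -pm in red.
have cartan := cartan_focus_algebra k0.
split; exists 2, (gram4 (1 - dot (vector_sum p) e3 ^+ 2)), (focus_algebra R).
  by [].
by split=> //; exact: focus_algebra_williamson.
Qed.
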